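(* Consider the symmetric diamond network with orthogonal broadcast links ($C_1=C_2=C\ge0$) and the binary adder MAC. Let $p^{(1)}=\frac{1}{1+\sqrt2}$. If $C\le 0.75$ or $C\ge 1-\frac{p^{(1)}}{2}$, then $$C^\diamond=\max_{0\le p\le\frac12}\min\Big\{2C,\ C+h_2(p),\ h_2(p)+1-p,\ C+h_2(p)-\tfrac p2\Big\}=\max_{0\le p\le\frac12}\min\Big\{2C-1+h_2(p),\ C+h_2(p),\ h_2(p)+1-p\Big\},$$ i.e. the upper bound of Corollary 2 (derived from Theorem 2) meets the lower bound of Theorem 1.
   Context: Diamond network with orthogonal broadcast component: a message $W$ uniform on $\{1,\dots,2^{nR}\}$ is encoded into $(V_1^n,V_2^n)$ with $H(V_1^n)\le nC_1$, $H(V_2^n)\le nC_2$; $V_i^n$ is delivered without error to relay $i$, which maps it to $X_i^n\in\{0,1\}^n$. The binary adder MAC outputs $Y_l=X_{1,l}+X_{2,l}\in\{0,1,2\}$. A decoder forms $\hat W$ from $Y^n$; $R$ is achievable if $\Pr(\hat W\ne W)$ can be made arbitrarily small for some $n$; $C^\diamond$ is the supremum of achievable rates. $h_2(q)=-q\log_2 q-(1-q)\log_2(1-q)$ is the binary entropy function. *)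

(* Defs.v *)
From Stdlib Require Import Reals Lra List.
Import ListNotations.
Open Scope R_scope.

Definition log2 (x : R) : R := ln x / ln 2.

Definition xlog2x (x : R) : R := if Rle_dec x 0 then 0 else x * log2 x.

Definition h2 (q : R) : R := - xlog2x q - xlog2x (1 - q).

Definition rsum (l : list nat) (f : nat -> R) : R :=
  fold_right (fun w acc => f w + acc) 0 l.

Definition cnt (M : nat) (f : nat -> nat) (v : nat) : nat :=
  length (filter (fun w => Nat.eqb (f w) v) (seq 0 M)).

(* Entropy (in bits) of f(W), W uniform on {0,..,M-1}:
   H(f(W)) = sum_w (1/M) * (- log2 P(f(W) = f(w))). *)
Definition entropy_unif (M : nat) (f : nat -> nat) : R :=
  rsum (seq 0 M) (fun w => (1 / INR M) * - log2 (INR (cnt M f (f w)) / INR M)).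

(* A code of block length n with M messages (messages labelled 0..M-1):
   encoders f1 f2 : message -> V_i^n (alphabet encoded in nat, wlog),
   relay maps g1 g2 : V_i^n -> X_i^n in {0,1}^n (coordinate l < n),
   decoder d : Y^n (list of length n over {0,1,2}) -> message. *)
Record code := mkCode {
  enc1 : nat -> nat; enc2 : nat -> nat;
  rel1 : nat -> nat -> bool; rel2 : nat -> nat -> bool;
  dec : list nat -> nat }.

Definition output (n : nat) (c : code) (w : nat) : list nat :=
  map (fun l => (Nat.b2n (rel1 c (enc1 c w) l) + Nat.b2n (rel2 c (enc2 c w) l))%nat)
      (seq 0 n).

Definition perr (n M : nat) (c : code) : R :=
  INR (length (filter (fun w => negb (Nat.eqb (dec c (output n c w)) w)) (seq 0 M)))
  / INR M.

Definition achievable (C1 C2 Rt : R) : Prop :=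
  forall eps, 0 < eps ->
    exists (n M : nat) (c : code),
      (1 <= n)%nat /\
      INR M - 1 < Rpower 2 (INR n * Rt) <= INR M /\
      entropy_unif M (enc1 c) <= INR n * C1 /\
      entropy_unif M (enc2 c) <= INR n * C2 /\
      perr n M c <= eps.

Definition is_max_half (f : R -> R) (V : R) : Prop :=
  (exists p, 0 <= p <= 1/2 /\ f p = V) /\
  (forall p, 0 <= p <= 1/2 -> f p <= V).

Definition p1 : R := 1 / (1 + sqrt 2).

Definition lower_fun (C p : R) : R :=
  Rmin (Rmin (2 * C) (C + h2 p)) (Rmin (h2 p + 1 - p) (C + h2 p - p / 2)).

Definition upper_fun (C p : R) : R :=
  Rmin (Rmin (2 * C - 1 + h2 p) (C + h2 p)) (h2 p + 1 - p).

(* Main.v *)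
Require Import Defs.
From Stdlib Require Import Reals Lra.
From HB Require Import structures.
From mathcomp Require Import all_boot all_algebra.
Set Implicit Arguments.
Unset Strict Implicit.
Unset Printing Implicit Defensive.
Open Scope R_scope.

(* Converse. Let U be a memoryless noisy version of the output Y. From
   I(V1;V2|U) >= 0 one gets
     H(V1,V2) + H(Y) <= H(V1) + H(V2) + H(U|V1) + H(U|V2) - 2 H(U|Y) + H(Y|U),
   whose right-hand side is bounded letter by letter. The kernel from Y to U is
   chosen so that X1 and X2 are independent given U when X1, X2 are uniform and
   P(X1 <> X2) = q; the letterwise bound is then affine in the mean density of
   ones in Y, and so is the bound on H(Y). With q the maximizer, either the bound
   on H(Y) is constant, or the two have opposite slopes and meet at q with value V.

   Achievability, without error. Take binary linear codes A1, A2 with m random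
   parity checks each. For at least half of the sets T of a given size > 2m, the
   2m checks restricted to T are independent, and then every output whose set of
   ones is T is a sum of a word of A1 and a word of A2. For C <= 3/4 the
   codes for the value C = 3/4 are used on a fraction of the positions. *)

(** * Finite sums and products of reals *)

HB.instance Definition _ := Monoid.isComLaw.Build R 0 Rplus
  (fun x y z => esym (Rplus_assoc x y z)) Rplus_comm Rplus_0_l.
HB.instance Definition _ := Monoid.isComLaw.Build R 1 Rmult
  (fun x y z => esym (Rmult_assoc x y z)) Rmult_comm Rmult_1_l.
HB.instance Definition _ := Monoid.isMulLaw.Build R 0 Rmult Rmult_0_l Rmult_0_r.
HB.instance Definition _ := Monoid.isAddLaw.Build R Rmult Rplus
  (fun x y z => Rmult_plus_distr_r x y z) (fun x y z => Rmult_plus_distr_l x y z).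

Delimit Scope R_scope with Re.
Notation "\rsum_ ( i | P ) F" := (\big[Rplus/0]_(i | P%B) F%Re)
  (at level 41, F at level 41, i at level 50) : R_scope.
Notation "\rsum_ i F" := (\big[Rplus/0]_i F%Re)
  (at level 41, F at level 41, i at level 0) : R_scope.
Notation "\rprod_ i F" := (\big[Rmult/1]_i F%Re)
  (at level 36, F at level 36, i at level 0) : R_scope.

Section Sums.
Variable I : finType.
Implicit Types (P : pred I) (F G : I -> R).

Lemma rsum_le P F G :
  (forall i, P i -> F i <= G i) -> \rsum_(i | P i) F i <= \rsum_(i | P i) G i.
Proof. by move=> h; elim/big_ind2: _ => //; [lra | move=> *; lra]. Qed.

Lemma rsum_ge0 P F : (forall i, P i -> 0 <= F i) -> 0 <= \rsum_(i | P i) F i.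
Proof. by move=> h; elim/big_ind: _ => //; [lra | move=> *; lra]. Qed.

Lemma rsum_gt0 P F i0 :
  P i0 -> (forall i, P i -> 0 < F i) -> 0 < \rsum_(i | P i) F i.
Proof.
move=> Pi0 h; rewrite (bigD1 i0) //=.
apply: Rplus_lt_le_0_compat; first exact: h.
by apply: rsum_ge0 => i /andP[/h Fi _]; lra.
Qed.

Lemma rsum_const P c : \rsum_(i | P i) c = INR #|P| * c.
Proof.
rewrite big_const; elim: #|P| => [|k IH]; first by rewrite /=; ring.
by rewrite iterS IH S_INR; ring.
Qed.

Lemma rsum_split P F G :
  \rsum_(i | P i) (F i + G i) = \rsum_(i | P i) F i + \rsum_(i | P i) G i.
Proof. exact: big_split. Qed.

Lemma rsum_mulr P F c : \rsum_(i | P i) (c * F i) = c * \rsum_(i | P i) F i.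
Proof. by rewrite big_distrr. Qed.

Lemma rsum_opp P F : \rsum_(i | P i) (- F i) = - \rsum_(i | P i) F i.
Proof.
rewrite (eq_bigr (fun i => -1 * F i)); last by move=> *; ring.
by rewrite rsum_mulr; ring.
Qed.

Lemma rprod_gt0 F : (forall i, 0 < F i) -> 0 < \rprod_i F i.
Proof. by move=> h; elim/big_ind: _ => //; [lra | exact: Rmult_lt_0_compat]. Qed.

Lemma ln_rprod F : (forall i, 0 < F i) -> ln (\rprod_i F i) = \rsum_i ln (F i).
Proof.
move=> h.
apply: (proj1 (_ : _ /\ 0 < \rprod_i F i)).
apply: (big_rec2 (fun x y => ln x = y /\ 0 < x)).
  by rewrite ln_1; split => //; lra.
move=> i x y _ [<- hx]; rewrite ln_mult //.
by split=> //; apply: Rmult_lt_0_compat.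
Qed.
End Sums.

(** Distributivity, in the form that normalises a product law on words letter by letter. *)
Lemma rsum_prod_ffun (I J : finType) (F : I -> J -> R) :
  \rsum_u \rprod_i F i ((u : {ffun I -> J}) i) = \rprod_i \rsum_j F i j.
Proof. by rewrite bigA_distr_bigA. Qed.

Lemma ln_divE x y : 0 < x -> 0 < y -> ln (x / y) = ln x - ln y.
Proof.
move=> x0 y0; rewrite /Rdiv ln_mult ?ln_Rinv //.
exact: Rinv_0_lt_compat.
Qed.

Lemma ln_le_mono x y : 0 < x -> x <= y -> ln x <= ln y.
Proof. by move=> x0 [/(ln_increasing _ _ x0) /Rlt_le | ->] //; apply: Rle_refl. Qed.

Lemma ln_le_sub1 x : 0 < x -> ln x <= x - 1.
Proof.
move=> x0; case: (Req_dec (ln x) 0) => [h|h].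
  by rewrite h; have := exp_ln x x0; rewrite h exp_0; lra.
by have := exp_ineq1 _ h; rewrite exp_ln //; lra.
Qed.

(** * Laws on a finite space, Gibbs' inequality, entropy *)

Section Mass.
Variables (O : finType) (P : O -> R).
Hypothesis P_gt0 : forall o, 0 < P o.

Definition mass (T : eqType) (f : O -> T) (t : T) : R := \rsum_(o | f o == t) P o.

Lemma mass_ge0 (T : eqType) (f : O -> T) t : 0 <= mass f t.
Proof. by apply: rsum_ge0 => o _; apply: Rlt_le. Qed.

Lemma mass_gt0 (T : eqType) (f : O -> T) o : 0 < mass f (f o).
Proof. exact: (@rsum_gt0 _ _ _ o). Qed.

Lemma mass_fiber (T : eqType) (T' : finType) (f : O -> T) (g : O -> T') t :
  \rsum_t' mass (fun o => (g o, f o)) (t', t) = mass f t.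
Proof.
rewrite [RHS](partition_big g xpredT) //=; apply: eq_bigr => t' _.
by apply: eq_bigl => o; rewrite xpair_eqE andbC.
Qed.

Lemma rsum_mass (T : finType) (f : O -> T) : \rsum_t mass f t = \rsum_o P o.
Proof. by rewrite [RHS](partition_big f xpredT). Qed.

(** Apply [ln x <= x - 1] pointwise at [x = G / mass]; grouped by fibers, the error terms sum to at
    most the total of [G] minus the total of [P]. [G] may vanish off the range of [f]. *)
Lemma gibbs (T : finType) (f : O -> T) (G : T -> R) :
  (forall o, 0 < G (f o)) -> (forall t, 0 <= G t) ->
  \rsum_t G t <= \rsum_o P o ->
  \rsum_o (P o * ln (G (f o))) <= \rsum_o (P o * ln (mass f (f o))).
Proof.
move=> Gf_gt0 G_ge0 sumG.
have step o : P o * ln (G (f o)) <=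
    P o * ln (mass f (f o)) + (P o * (G (f o) / mass f (f o)) - P o).
  have m0 := mass_gt0 f o.
  have q0 : 0 < G (f o) / mass f (f o) by apply: Rdiv_lt_0_compat.
  have := ln_le_sub1 q0; rewrite ln_divE // => h.
  have := Rmult_le_compat_l _ _ _ (Rlt_le _ _ (P_gt0 o)) h; lra.
apply: Rle_trans (rsum_le (fun o _ => step o)) _.
rewrite rsum_split.
suff : \rsum_o (P o * (G (f o) / mass f (f o)) - P o) <= 0 by lra.
rewrite rsum_split rsum_opp.
suff : \rsum_o (P o * (G (f o) / mass f (f o))) <= \rsum_t G t by lra.
rewrite (partition_big f xpredT) //=; apply: rsum_le => t _.
rewrite (eq_bigr (fun o => (G t / mass f t) * P o)); last first.
  by move=> o /eqP ->; ring.
rewrite rsum_mulr -/(mass f t).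
(* A value outside the range of [f] has mass 0, so its term is 0. *)
have [->|m0] := Req_dec (mass f t) 0; first by have := G_ge0 t; lra.
by apply: Req_le; field.
Qed.
End Mass.

(** Measured in nats. Summing over outcomes instead of values allows an infinite codomain, such as
    [nat] for the encoders. *)
Definition entropy (O : finType) (P : O -> R) (T : eqType) (f : O -> T) : R :=
  - \rsum_o (P o * ln (mass P f (f o))).

Section EntropyFacts.
Variables (O : finType) (P : O -> R).
Hypothesis P_gt0 : forall o, 0 < P o.
Hypothesis P_sum1 : \rsum_o P o = 1.

Lemma entropy_le_cross (T : finType) (f : O -> T) (G : T -> R) :
  (forall o, 0 < G (f o)) -> (forall t, 0 <= G t) -> \rsum_t G t <= 1 ->
  entropy P f <= - \rsum_o (P o * ln (G (f o))).
Proof.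
move=> h1 h2 h3; rewrite /entropy; apply: Ropp_le_contravar.
by apply: gibbs => //; rewrite P_sum1.
Qed.

(** The product of the two marginals serves as reference law in the cross entropy. *)
Lemma entropy_pair_le (T1 T2 : finType) (f1 : O -> T1) (f2 : O -> T2) :
  entropy P (fun o => (f1 o, f2 o)) <= entropy P f1 + entropy P f2.
Proof.
pose G (t : T1 * T2) := mass P f1 t.1 * mass P f2 t.2.
apply: Rle_trans (@entropy_le_cross _ _ G _ _ _) _ => /=.
- by move=> o; apply: Rmult_lt_0_compat; apply: mass_gt0.
- by move=> t; apply: Rmult_le_pos; apply: mass_ge0.
- rewrite -(pair_big xpredT xpredT (fun a b => mass P f1 a * mass P f2 b)) /=.
  under eq_bigr => a _ do rewrite rsum_mulr rsum_mass P_sum1 Rmult_1_r.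
  by rewrite rsum_mass P_sum1; lra.
rewrite /entropy -Ropp_plus_distr -rsum_split; apply/Req_le; congr (- _).
apply: eq_bigr => o _; rewrite /G /= ln_mult; last 2 first.
- exact: mass_gt0.
- exact: mass_gt0.
by ring.
Qed.

(** The fiber of [f2] through an outcome contains the fiber of [f1], so its mass is at least as
    large. *)
Lemma entropy_image_le (T1 T2 : eqType) (f1 : O -> T1) (f2 : O -> T2) :
  (forall o o', f1 o = f1 o' -> f2 o = f2 o') -> entropy P f2 <= entropy P f1.
Proof.
move=> h; apply: Ropp_le_contravar; apply: rsum_le => o _.
apply: Rmult_le_compat_l; first exact: Rlt_le.
apply: ln_le_mono; first exact: mass_gt0.
rewrite /mass [X in _ <= X](bigID (fun o' => f1 o' == f1 o)) /=.
rewrite [X in _ <= X + _](eq_bigl (fun o' => f1 o' == f1 o)); last first.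
  by move=> o'; apply/andP/idP => [[] //|e]; split=> //; apply/eqP/h/eqP.
suff: 0 <= \rsum_(o' | (f2 o' == f2 o) && (f1 o' != f1 o)) P o' by lra.
by apply: rsum_ge0 => o' _; apply: Rlt_le.
Qed.

(** The reference law is uniform on [A]. This turns the size of a code into a bound on the link
    load. *)
Lemma entropy_le_ln_card (T : finType) (f : O -> T) (A : {set T}) :
  (forall o, f o \in A) -> entropy P f <= ln (INR #|A|).
Proof.
move=> fA.
have [o _|nO] := pickP [pred o : O | true]; last first.
  by have := P_sum1; rewrite big_pred0 => [|o]; [lra | apply: nO].
have A_gt0 : 0 < INR #|A|.
  by apply: lt_0_INR; apply/ltP; apply/card_gt0P; exists (f o).
pose G (t : T) := if t \in A then / INR #|A| else 0.
apply: Rle_trans (@entropy_le_cross _ _ G _ _ _) _.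
- by move=> o'; rewrite /G fA; apply: Rinv_0_lt_compat.
- move=> t; rewrite /G; case: ifP => _; last lra.
  by apply: Rlt_le; apply: Rinv_0_lt_compat.
- rewrite -big_mkcond rsum_const (eq_card (B := A)) //.
  by apply/Req_le; field; lra.
under eq_bigr => o' _ do rewrite /G fA ln_Rinv // Rmult_comm.
by rewrite rsum_mulr P_sum1; lra.
Qed.

(* [u] is drawn from [y] through the kernel [K]. The chain is: I(v1;v2|u) >= 0,
   then the conditional entropies of [u] given [v1], of [u] given [v2] and of [y]
   given [u] are at most the cross entropies relative to [r1], [r2], [s]. The
   identity defining [c] removes [u] from the final bound. *)
Lemma entropy_auxiliary (V1 V2 Y U : finType) (v1 : O -> V1) (v2 : O -> V2)
    (y : O -> Y) (K : Y -> U -> R) (r1 : V1 -> U -> R) (r2 : V2 -> U -> R)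
    (s : U -> Y -> R) (c : Y -> R) :
  (forall o o', v1 o = v1 o' -> v2 o = v2 o' -> y o = y o') ->
  (forall t u, 0 < K t u) -> (forall t, \rsum_u K t u = 1) ->
  (forall t u, 0 < r1 t u) -> (forall t, \rsum_u r1 t u = 1) ->
  (forall t u, 0 < r2 t u) -> (forall t, \rsum_u r2 t u = 1) ->
  (forall u t, 0 < s u t) -> (forall u, \rsum_t s u t = 1) ->
  (forall t, 0 < c t) ->
  (forall o u, r1 (v1 o) u * r2 (v2 o) u * s u (y o) = c (y o) * (K (y o) u) ^ 2) ->
  entropy P (fun o => (v1 o, v2 o)) + entropy P y <=
    entropy P v1 + entropy P v2 - \rsum_o (P o * ln (c (y o))).
Proof.
move=> hy K0 K1 r10 r11 r20 r21 s0 s1 c0 id_c.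
pose Q (z : O * U) := P z.1 * K (y z.1) z.2.
have Q0 z : 0 < Q z by apply: Rmult_lt_0_compat.
have sumQ (F : O -> R) : \rsum_z (Q z * F z.1) = \rsum_o (P o * F o).
  rewrite -(pair_big xpredT xpredT (fun o u => P o * K (y o) u * F o)) /=.
  apply: eq_bigr => o _.
  under eq_bigr => u _ do rewrite Rmult_assoc (Rmult_comm (K _ _)) -Rmult_assoc.
  by rewrite rsum_mulr K1 Rmult_1_r.
have Q1 : \rsum_z Q z = 1.
  rewrite -P_sum1 (eq_bigr (fun z => Q z * 1)) => [|z _]; last by ring.
  by rewrite (sumQ (fun _ => 1)); apply: eq_bigr => o _; ring.
(* When [f] determines [y], the kernel factors out of the joint law of [f] and [u]. This is applied
   to the pair [(v1, v2)] and to [y] itself. *)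
have massQ2 (T : eqType) (f : O -> T) o u :
    (forall o', f o' = f o -> y o' = y o) ->
    mass Q (fun z => (f z.1, z.2)) (f o, u) = mass P f (f o) * K (y o) u.
  move=> fy; rewrite /mass.
  rewrite -(pair_big (fun o' => f o' == f o) (fun u' => u' == u)
             (fun o' u' => P o' * K (y o') u')) /=.
  rewrite Rmult_comm -rsum_mulr; apply: eq_bigr => o' /eqP /fy ->.
  by rewrite big_pred1_eq Rmult_comm.
pose m12 := mass P (fun o => (v1 o, v2 o)).
pose m1 := mass P v1; pose m2 := mass P v2; pose my := mass P y.
pose mu := mass Q (fun z => z.2).
pose m1u := mass Q (fun z => (v1 z.1, z.2)).
pose m2u := mass Q (fun z => (v2 z.1, z.2)).
have [o0 _|nO] := pickP [pred o : O | true]; last first.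
  by have := P_sum1; rewrite big_pred0 => [|o]; [lra | apply: nO].
have mu0 u : 0 < mu u by apply: (@mass_gt0 _ Q Q0 _ (fun z => z.2) (o0, u)).
have m10 o : 0 < m1 (v1 o) by apply: mass_gt0.
have m20 o : 0 < m2 (v2 o) by apply: mass_gt0.
have my0 o : 0 < my (y o) by apply: mass_gt0.
have m120 o : 0 < m12 (v1 o, v2 o).
  by apply: (@mass_gt0 _ P P_gt0 _ (fun o => (v1 o, v2 o))).
have m1u0 z : 0 < m1u (v1 z.1, z.2).
  by apply: (@mass_gt0 _ Q Q0 _ (fun z => (v1 z.1, z.2))).
have m2u0 z : 0 < m2u (v2 z.1, z.2).
  by apply: (@mass_gt0 _ Q Q0 _ (fun z => (v2 z.1, z.2))).
(* This is I(v1;v2|u) >= 0: the reference law keeps the laws of [(v1, u)] and [(v2, u)] but makes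
   [v1] and [v2] independent given [u]. *)
have g1 : \rsum_z (Q z * ln (m1u (v1 z.1, z.2) * m2u (v2 z.1, z.2) / mu z.2)) <=
    \rsum_z (Q z * ln (m12 (v1 z.1, v2 z.1) * K (y z.1) z.2)).
  rewrite [X in _ <= X](eq_bigr (fun z => Q z * ln (mass Q (fun z' => ((v1 z'.1, v2 z'.1), z'.2))
             ((v1 z.1, v2 z.1), z.2)))) => [|z _]; last first.
    rewrite (@massQ2 _ (fun o => (v1 o, v2 o)) z.1) // => o' [e1 e2].
    exact: hy.
  apply: (@gibbs _ Q Q0 _ (fun z => ((v1 z.1, v2 z.1), z.2))
    (fun t => m1u (t.1.1, t.2) * m2u (t.1.2, t.2) / mu t.2)) => /=.
  - by move=> z; apply: Rdiv_lt_0_compat => //; apply: Rmult_lt_0_compat.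
  - move=> t; apply: Rmult_le_pos; last by apply/Rlt_le/Rinv_0_lt_compat.
    by apply: Rmult_le_pos; apply: mass_ge0.
  rewrite -(pair_big xpredT xpredT
    (fun a u => m1u (a.1, u) * m2u (a.2, u) / mu u)) /= exchange_big /=.
  rewrite -(rsum_mass Q (fun z => z.2)); apply: rsum_le => u _; apply/Req_le.
  rewrite -(pair_big xpredT xpredT
    (fun a b => m1u (a, u) * m2u (b, u) / mu u)) /=.
  under eq_bigr => a _.
    rewrite (eq_bigr (fun b => (m1u (a, u) / mu u) * m2u (b, u))); last first.
      by move=> b _ /=; rewrite /Rdiv; ring.
    rewrite rsum_mulr (mass_fiber Q (fun z => z.2) (fun z => v2 z.1)) -/(mu u).
    rewrite (_ : _ * _ = m1u (a, u)); last by field; have := mu0 u; lra.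
    over.
  exact: (mass_fiber Q (fun z => z.2) (fun z => v1 z.1)).
(* H(v,u) is at most H(v) plus the cross entropy of [u] given [v] relative to [r]. *)
have gV (V : finType) (v : O -> V) (r : V -> U -> R) :
    (forall t u, 0 < r t u) -> (forall t, \rsum_u r t u = 1) ->
    \rsum_z (Q z * ln (mass P v (v z.1) * r (v z.1) z.2)) <=
    \rsum_z (Q z * ln (mass Q (fun z' => (v z'.1, z'.2)) (v z.1, z.2))).
  move=> r0 rs.
  apply: (@gibbs _ Q Q0 _ (fun z => (v z.1, z.2))
           (fun t => mass P v t.1 * r t.1 t.2)) => /=.
  - by move=> z; apply: Rmult_lt_0_compat => //; apply: mass_gt0.
  - by move=> t; apply: Rmult_le_pos; [apply: mass_ge0 | apply: Rlt_le].
  rewrite -(pair_big xpredT xpredT (fun a u => mass P v a * r a u)) /= Q1 -P_sum1.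
  rewrite -(rsum_mass P v); apply/Req_le; apply: eq_bigr => a _.
  by rewrite rsum_mulr rs Rmult_1_r.
have g2 := gV _ v1 r1 r10 r11; have g3 := gV _ v2 r2 r20 r21.
(* Here H(y,u) is expanded as H(y) + H(u|y) and bounded by H(u) plus the cross entropy of [y]
   relative to [s]. *)
have g4 : \rsum_z (Q z * ln (mu z.2 * s z.2 (y z.1))) <=
    \rsum_z (Q z * ln (my (y z.1) * K (y z.1) z.2)).
  rewrite [X in _ <= X](eq_bigr (fun z => Q z * ln (mass Q (fun z' => (y z'.1, z'.2))
             (y z.1, z.2)))) => [|z _]; last by rewrite massQ2.
  apply: (@gibbs _ Q Q0 _ (fun z => (y z.1, z.2)) (fun t => mu t.2 * s t.2 t.1)) => /=.
  - by move=> z; apply: Rmult_lt_0_compat.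
  - by move=> t; apply: Rmult_le_pos; apply: Rlt_le.
  rewrite -(pair_big xpredT xpredT (fun t u => mu u * s u t)) /= exchange_big /=.
  rewrite -(rsum_mass Q (fun z => z.2)); apply/Req_le; apply: eq_bigr => u _.
  by rewrite rsum_mulr s1 Rmult_1_r.
(* In the sum of the four inequalities the masses involving [u] cancel; what remains is
   [ln r1 + ln r2 + ln s - 2 ln K], which is [ln c]. *)
have key : \rsum_z (Q z * (ln (m1 (v1 z.1)) + ln (m2 (v2 z.1)) + ln (c (y z.1)))) <=
    \rsum_z (Q z * (ln (m12 (v1 z.1, v2 z.1)) + ln (my (y z.1)))).
  have := Rplus_le_compat _ _ _ _ g1 (Rplus_le_compat _ _ _ _ g2
            (Rplus_le_compat _ _ _ _ g3 g4)).
  rewrite -!rsum_split => g.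
  suff : \rsum_z (Q z * (ln (m1 (v1 z.1)) + ln (m2 (v2 z.1)) + ln (c (y z.1))) -
    Q z * (ln (m12 (v1 z.1, v2 z.1)) + ln (my (y z.1)))) <= 0.
    by rewrite rsum_split rsum_opp; lra.
  apply: Rle_trans (_ : _ <= \rsum_z _ - \rsum_z _) (Rle_minus _ _ g).
  rewrite /Rminus -rsum_opp -rsum_split; apply/Req_le; apply: eq_bigr => z _.
  have := f_equal ln (id_c z.1 z.2).
  rewrite -/m1 -/m2 -/m1u -/m2u ln_divE // ?ln_mult //= ?ln_1; last 5 first.
  - lra.
  - by apply: Rmult_lt_0_compat => //; lra.
  - by do 2! [apply: Rmult_lt_0_compat => //]; lra.
  - exact: Rmult_lt_0_compat.
  - exact: Rmult_lt_0_compat.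
  set a := ln (r1 _ _); set b := ln (r2 _ _); set d := ln (s _ _) => e.
  by rewrite (_ : ln (c _) = a + b + d - 2 * ln (K (y z.1) z.2)); [ring | lra].
rewrite (sumQ (fun o => ln (m1 (v1 o)) + ln (m2 (v2 o)) + ln (c (y o)))) in key.
rewrite (sumQ (fun o => ln (m12 (v1 o, v2 o)) + ln (my (y o)))) in key.
move: key; rewrite /entropy -/m12 -/m1 -/m2 -/my.
under eq_bigr do rewrite !Rmult_plus_distr_l.
under [X in _ <= X -> _]eq_bigr do rewrite Rmult_plus_distr_l.
by rewrite !rsum_split; lra.
Qed.

End EntropyFacts.

(** * Converse bounds for the adder channel *)

Definition adder (b1 b2 : bool) : option bool := if b1 == b2 then Some b1 else None.

Lemma rsum_option_bool (F : option bool -> R) :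
  \rsum_t F t = F None + F (Some true) + F (Some false).
Proof.
rewrite (bigD1 None) //= (bigD1 (Some true)) //= (bigD1 (Some false)) //=.
rewrite big_pred0; first by rewrite Rplus_0_r Rplus_assoc.
by move=> [[]|].
Qed.

Lemma rsum_bool (F : bool -> R) : \rsum_b F b = F true + F false.
Proof.
rewrite (bigD1 true) //= (bigD1 false) //= big_pred0 ?Rplus_0_r //.
by move=> [].
Qed.

Section AdderConverse.
Variables (O : finType) (P : O -> R) (n : nat).
Hypothesis P_gt0 : forall o, 0 < P o.
Hypothesis P_sum1 : \rsum_o P o = 1.

(** The output 1 is encoded as [None] and the output 2b as [Some b], so the ones are the positions
    where the inputs differ. *)
Definition num_ones (y : {ffun 'I_n -> option bool}) : R :=
  \rsum_l (if y l is None then 1 else 0).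

(** A letter cost that takes the same value on the outputs 0 and 2 sees only the number of ones;
    hence the entropy bounds are affine in [N]. *)
Lemma rsum_letters (y : {ffun 'I_n -> option bool}) (F : option bool -> R) b :
  F (Some true) = b -> F (Some false) = b ->
  \rsum_l F (y l) = num_ones y * F None + (INR n - num_ones y) * b.
Proof.
move=> ht hf; rewrite /num_ones.
have e : INR n = \big[Rplus/0]_(l < n) 1 by rewrite rsum_const card_ord Rmult_1_r.
rewrite e /Rminus -rsum_opp -rsum_split (Rmult_comm _ (F None)) (Rmult_comm _ b).
rewrite -!rsum_mulr -rsum_split; apply: eq_bigr => l _.
by case: (y l) => [[]|]; rewrite ?ht ?hf; ring.
Qed.

(** Cross entropy relative to independent letters that are 1 with probability [q] and 0 or 2 with
    probability [(1 - q) / 2] each. *)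
Lemma entropy_output_le (f : O -> {ffun 'I_n -> option bool}) q : 0 < q < 1 ->
  let N := \rsum_o (P o * num_ones (f o)) in
  entropy P f <= - (N * ln q + (INR n - N) * (ln (1 - q) - ln 2)).
Proof.
move=> hq N.
pose Q (t : option bool) := if t is None then q else (1 - q) / 2.
have Q0 t : 0 < Q t by case: t => [b|] /=; lra.
apply: Rle_trans (entropy_le_cross P_gt0 P_sum1 (f := f)
  (G := fun t : {ffun 'I_n -> option bool} => \rprod_l Q (t l)) _ _ _) _.
- by move=> o; apply: rprod_gt0.
- by move=> t; apply/Rlt_le/rprod_gt0.
- rewrite (rsum_prod_ffun (fun (_ : 'I_n) t => Q t)) big1; first lra.
  by move=> l _; rewrite rsum_option_bool /=; field.
apply/Req_le; congr (- _).
transitivity (\rsum_o (ln q * (P o * num_ones (f o)) +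
    (ln (1 - q) - ln 2) * (INR n * P o - P o * num_ones (f o)))).
  apply: eq_bigr => o _; rewrite ln_rprod //.
  rewrite (@rsum_letters _ (fun t => ln (Q t)) (ln (1 - q) - ln 2)) /= ?ln_divE //; try lra.
by rewrite rsum_split !rsum_mulr rsum_split rsum_mulr rsum_opp P_sum1 -/N; ring.
Qed.

(* Given [u], the inputs are independent, each equal to [u] with a bit flipped
   with probability [a]; hence P(x1 <> x2) = 2 a (1 - a). *)
Lemma entropy_adder_le (V1 V2 : finType) (v1 : O -> V1) (v2 : O -> V2)
    (x1 : V1 -> {ffun 'I_n -> bool}) (x2 : V2 -> {ffun 'I_n -> bool}) a q :
  0 < a < 1 -> q = 2 * a * (1 - a) ->
  let y o := [ffun l => adder (x1 (v1 o) l) (x2 (v2 o) l)] in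
  let N := \rsum_o (P o * num_ones (y o)) in
  entropy P (fun o => (v1 o, v2 o)) + entropy P y <=
    entropy P v1 + entropy P v2
      - (N * (ln 2 + 2 * ln q) + (INR n - N) * (2 * ln (1 - q))).
Proof.
move=> ha hq y N.
have q0 : 0 < q by rewrite hq; nra.
have q1 : 0 < 1 - q by rewrite hq; nra.
(* [r] and [s] are the laws of an input and of the output given [u], and [k] is the posterior of a
   uniform [u] given the output. Then [r * r * s = c * k ^ 2] with [c] free of [u]: for equal inputs
   both factors [r * r] and [s] are [(1 - q) * k]; for different ones they are [q / 2] and [q],
   while [k = 1/2]. *)
pose r (b u : bool) := if b == u then 1 - a else a.
pose s (u : bool) (t : option bool) := if t is Some b then r b u * r b u else q.
pose k (t : option bool) (u : bool) := if t is Some b then r b u * r b u / (1 - q) else 1/2.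
pose c (t : option bool) := if t is Some _ then (1 - q) * (1 - q) else 2 * (q * q).
have r0 b u : 0 < r b u by rewrite /r; case: ifP => _; lra.
have s0 u t : 0 < s u t by case: t => [b|] //=; apply: Rmult_lt_0_compat.
have k0 t u : 0 < k t u.
  case: t => [b|] /=; last lra.
  by apply: Rdiv_lt_0_compat => //; apply: Rmult_lt_0_compat.
have c0 t : 0 < c t by case: t => [b|] /=; nra.
have r1 b : \rsum_u r b u = 1 by rewrite rsum_bool; case: b; rewrite /r /=; ring.
have s1 u : \rsum_t s u t = 1.
  by rewrite rsum_option_bool; case: u; rewrite /s /r /= hq; ring.
have k1 t : \rsum_u k t u = 1.
  rewrite rsum_bool; case: t => [b|] /=; last by field.
  by rewrite -Rdiv_plus_distr; apply: (Rmult_eq_reg_r (1 - q)); last lra;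
     rewrite /Rdiv Rmult_assoc Rinv_l; [case: b; rewrite /r /= hq; ring | lra].
have letter b1 b2 u :
    r b1 u * r b2 u * s u (adder b1 b2) = c (adder b1 b2) * (k (adder b1 b2) u) ^ 2.
  rewrite /adder; case: eqP => [<-|] /=; first by rewrite /k; field; lra.
  by case: b1; case: b2; case: u => //= _; rewrite /r /= hq; field.
have prod1 (T J : finType) (F : T -> J -> R) (w : {ffun 'I_n -> T}) :
    (forall t, \rsum_j F t j = 1) ->
    \rsum_u \rprod_l F (w l) ((u : {ffun 'I_n -> J}) l) = 1.
  by move=> F1; rewrite (rsum_prod_ffun (fun l j => F (w l) j)) big1.
(* The kernels on words are the products of the letter kernels. *)
have := @entropy_auxiliary _ _ P_gt0 P_sum1 _ _ _ {ffun 'I_n -> bool} v1 v2 y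
  (fun t u => \rprod_l k (t l) (u l))
  (fun t u => \rprod_l r (x1 t l) (u l)) (fun t u => \rprod_l r (x2 t l) (u l))
  (fun u t => \rprod_l s (u l) (t l)) (fun t => \rprod_l c (t l)).
move=> /(_ _ _ (fun t => prod1 _ _ k t k1) _ (fun t => prod1 _ _ r (x1 t) r1)
  _ (fun t => prod1 _ _ r (x2 t) r1) _ (fun u => prod1 _ _ s u s1)) h.
apply: Rle_trans (h _ _ _ _ _ _ _) _.
- by move=> o o' e1 e2; rewrite /y e1 e2.
- by move=> t u; apply: rprod_gt0.
- by move=> t u; apply: rprod_gt0.
- by move=> t u; apply: rprod_gt0.
- by move=> t u; apply: rprod_gt0.
- by move=> t; apply: rprod_gt0.
- move=> o u; rewrite /= Rmult_1_r -!big_split; apply: eq_bigr => l _.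
  by rewrite /y ffunE /= letter /= Rmult_1_r.
apply/Req_le; congr (_ - _).
transitivity (\rsum_o ((ln 2 + 2 * ln q) * (P o * num_ones (y o)) +
    (2 * ln (1 - q)) * (INR n * P o - P o * num_ones (y o)))).
  apply: eq_bigr => o _; rewrite ln_rprod //.
  rewrite (@rsum_letters _ (fun t => ln (c t)) (2 * ln (1 - q))) /= ?ln_mult //; try nra.
by rewrite rsum_split !rsum_mulr rsum_split rsum_mulr rsum_opp P_sum1 -/N; ring.
Qed.
End AdderConverse.

(** * Uniform messages and Fano's inequality *)

Section Uniform.
Variable M : nat.
Hypothesis M_gt0 : (0 < M)%N.
Let unif (w : 'I_M) := / INR M.

Lemma unif_gt0 w : 0 < unif w.
Proof. by apply/Rinv_0_lt_compat/lt_0_INR/ltP. Qed.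

Lemma unif_sum1 : \rsum_w unif w = 1.
Proof.
rewrite rsum_const card_ord; apply: Rinv_r.
by apply: not_0_INR; case: M M_gt0.
Qed.

Lemma mass_unif (T : eqType) (f : 'I_M -> T) t :
  mass unif f t = INR #|[pred w | f w == t]| / INR M.
Proof. by rewrite /mass rsum_const. Qed.

(* [d w] is the decoded message. A correctly decoded [w] shares its output only
   with erroneous messages, and ln k <= k - 1. *)
Lemma fano_unif (T : eqType) (y : 'I_M -> T) (d : 'I_M -> nat) :
  (forall w w', y w = y w' -> d w = d w') ->
  ln (INR M) - entropy unif y <=
    INR #|[pred w : 'I_M | d w != w]| / INR M * (ln (INR M) + 1).
Proof.
move=> hd.
have M0 : 0 < INR M by apply/lt_0_INR/ltP.
pose cy w := INR #|[pred w' | y w' == y w]|.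
have cy0 w : 0 < cy w.
  by apply/lt_0_INR/ltP/card_gt0P; exists w; rewrite inE.
have -> : ln (INR M) - entropy unif y = / INR M * \rsum_w ln (cy w).
  have -> : ln (INR M) = \big[Rplus/0]_(w < M) (/ INR M * ln (INR M)).
    by rewrite rsum_const card_ord; field; lra.
  rewrite /entropy /Rminus Ropp_involutive -rsum_split -rsum_mulr.
  by apply: eq_bigr => w _; rewrite mass_unif -/(cy w) ln_divE // /unif; ring.
rewrite /Rdiv (Rmult_comm (INR _)) Rmult_assoc; apply: Rmult_le_compat_l.
  by apply/Rlt_le/Rinv_0_lt_compat.
(* An erroneous message contributes at most [ln M]; the correct ones together contribute at most the
   number of erroneous messages. *)
rewrite (bigID (fun w : 'I_M => d w != w)) /= Rmult_plus_distr_l Rmult_1_r.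
apply: Rplus_le_compat.
  apply: Rle_trans (rsum_le (G := fun _ => ln (INR M)) _) _ => [w _|].
    by apply: ln_le_mono => //; apply/le_INR/leP; rewrite -[X in (_ <= X)%N](card_ord M) max_card.
  by rewrite rsum_const; apply: Req_le.
apply: Rle_trans (rsum_le (G := fun w => \rsum_(w' | (d w' != w') && (y w' == y w)) 1) _) _.
  move=> w; rewrite negbK => /eqP dw.
  have := ln_le_sub1 (cy0 w); suff -> : cy w = 1 +
    \rsum_(w' | (d w' != w') && (y w' == y w)) 1 by lra.
  rewrite rsum_const Rmult_1_r /cy [in LHS](cardD1 w) inE eqxx plus_INR; congr (_ + INR _).
  apply: eq_card => w'; rewrite !inE unfold_in.
  case: (y w' =P y w) => [/hd dw'|]; last by rewrite !andbF.
  by rewrite !andbT dw' dw eq_sym.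
(* Counted the other way, each erroneous message shares its output with at most one correctly
   decoded message, namely the decoded value. *)
rewrite (exchange_big_dep (fun w' : 'I_M => d w' != w')) /=; last by move=> w w' _ /andP[].
apply: Rle_trans (rsum_le (G := fun _ => 1) _) _; last first.
  by rewrite rsum_const Rmult_1_r; apply: Req_le.
move=> w' ew'; rewrite rsum_const Rmult_1_r -[X in _ <= X]/(INR 1).
apply/le_INR/leP/card_le1_eqP => w1 w2.
rewrite !unfold_in !negbK => /and3P[/eqP d1 _ /eqP/hd e1] /and3P[/eqP d2 _ /eqP/hd e2].
by apply: val_inj; rewrite /= -d1 -d2 -e1 -e2.
Qed.
End Uniform.

(** * Translation of the code model, and the converse for rates *)

Lemma list_seqE a k : List.seq a k = iota a k.
Proof. by elim: k a => [|k IH] a //=; rewrite IH. Qed.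

Lemma list_filterE (p : nat -> bool) l : List.length (List.filter p l) = count p l.
Proof. by elim: l => [|x l IH] //=; case: (p x) => /=; rewrite IH. Qed.

Lemma count_iota (p : pred nat) M : count p (iota 0 M) = #|[pred w : 'I_M | p w]|.
Proof. by rewrite -val_enum_ord count_map cardE size_filter enumT. Qed.

Lemma rsum_seqE M F : rsum (List.seq 0 M) F = \big[Rplus/0]_(w < M) F w.
Proof.
rewrite list_seqE -(big_mkord xpredT) /index_iota subn0.
elim: (iota 0 M) => [|x l IH]; first by rewrite big_nil.
by rewrite big_cons -IH.
Qed.

Lemma entropy_unifE M (f : nat -> nat) : (0 < M)%N ->
  entropy_unif M f * ln 2 = entropy (fun _ : 'I_M => / INR M) (fun w : 'I_M => f w).
Proof.
move=> M0; rewrite /entropy_unif rsum_seqE /entropy -rsum_opp Rmult_comm -rsum_mulr.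
apply: eq_bigr => w _; rewrite mass_unif /log2.
have -> : cnt M f (f w) = #|[pred w' : 'I_M | f w' == f w]|.
  rewrite /cnt list_filterE list_seqE count_iota; apply: eq_card => w'.
  by rewrite !inE; apply/Nat.eqb_spec/eqP.
by field; split; [apply: not_0_INR; case: M M0 w | have := ln_lt_2; lra].
Qed.

Lemma perrE n M c : perr n M c =
  INR #|[pred w : 'I_M | dec c (output n c w) != w]| / INR M.
Proof.
rewrite /perr list_filterE list_seqE count_iota; congr (INR _ / _).
Qed.

Lemma ln2_gt0 : 0 < ln 2.
Proof. by have := ln_lt_2; lra. Qed.

(** [H] is the output entropy in nats and [N] the expected number of ones. The four bounds are Fano,
    the cut around the two links, the output law, and the auxiliary bound combined with H(Y) <=
    H(V1,V2). *)
Lemma code_converse n M c C1 C2 a q :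
  (0 < M)%N -> 0 < a < 1 -> q = 2 * a * (1 - a) ->
  entropy_unif M (enc1 c) <= INR n * C1 -> entropy_unif M (enc2 c) <= INR n * C2 ->
  exists H N : R,
    [/\ ln (INR M) - H <= perr n M c * (ln (INR M) + 1),
        H <= INR n * (C1 + C2) * ln 2,
        H <= - (N * ln q + (INR n - N) * (ln (1 - q) - ln 2))
      & 2 * H <= INR n * (C1 + C2) * ln 2
                   - (N * (ln 2 + 2 * ln q) + (INR n - N) * (2 * ln (1 - q)))].
Proof.
move=> M0 ha hq e1 e2.
pose unif (w : 'I_M) := / INR M.
have u0 : forall w, 0 < unif w := unif_gt0 M0.
have u1 : \rsum_w unif w = 1 := unif_sum1 M0.
(* The auxiliary bound needs finite alphabets, so encoder values are cut off at their maximum over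
   the messages. *)
have bnd (f : nat -> nat) (w : 'I_M) : (f w < (\max_(w' < M) f w').+1)%N.
  by rewrite ltnS (leq_bigmax w).
pose v1 w := Ordinal (bnd (enc1 c) w); pose v2 w := Ordinal (bnd (enc2 c) w).
pose x1 (v : 'I_(\max_(w' < M) enc1 c w').+1) := [ffun l : 'I_n => rel1 c v l].
pose x2 (v : 'I_(\max_(w' < M) enc2 c w').+1) := [ffun l : 'I_n => rel2 c v l].
pose y w := [ffun l => adder (x1 (v1 w) l) (x2 (v2 w) l)].
have H1 : entropy unif v1 <= INR n * C1 * ln 2.
  apply: Rle_trans (Rmult_le_compat_r _ _ _ (Rlt_le _ _ ln2_gt0) e1).
  rewrite entropy_unifE //; apply: (entropy_image_le u0 (f1 := fun w : 'I_M => enc1 c w)).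
  by move=> w w' e; apply: val_inj.
have H2 : entropy unif v2 <= INR n * C2 * ln 2.
  apply: Rle_trans (Rmult_le_compat_r _ _ _ (Rlt_le _ _ ln2_gt0) e2).
  rewrite entropy_unifE //; apply: (entropy_image_le u0 (f1 := fun w : 'I_M => enc2 c w)).
  by move=> w w' e; apply: val_inj.
have hY : entropy unif y <= entropy unif (fun w => (v1 w, v2 w)).
  by apply: (entropy_image_le u0) => w w' [f1 f2]; rewrite /y /x1 /x2 /= f1 f2.
have h12 : entropy unif (fun w => (v1 w, v2 w)) <= entropy unif v1 + entropy unif v2.
  exact: entropy_pair_le.
exists (entropy unif y), (\rsum_w (unif w * num_ones (y w))); split.
- rewrite perrE; apply: (fano_unif M0 (d := fun w => dec c (output n c w))) => w w' eyw.
  congr (dec c _); rewrite /output list_seqE; apply/eq_in_map => l.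
  rewrite mem_iota add0n /= => ltl.
  have := congr1 (fun f : {ffun 'I_n -> option bool} => f (Ordinal ltl)) eyw.
  rewrite !ffunE /adder /=.
  by do 4! case: (_ c _ l).
- lra.
- by apply: (entropy_output_le u0 u1); rewrite hq; nra.
- set N := \rsum_w _.
  have h : entropy unif (fun w => (v1 w, v2 w)) + entropy unif y <=
      entropy unif v1 + entropy unif v2
        - (N * (ln 2 + 2 * ln q) + (INR n - N) * (2 * ln (1 - q))).
    exact: (entropy_adder_le u0 u1 v1 v2 x1 x2 ha hq).
  lra.
Qed.

(** A rate above [V] would contradict Fano's inequality as soon as the error probability is small,
    at any block length. *)
Lemma achievable_le C1 C2 Rt V a q :
  0 <= V -> 0 < a < 1 -> q = 2 * a * (1 - a) ->
  (forall (n : nat) (H N : R), (1 <= n)%coq_nat ->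
     H <= INR n * (C1 + C2) * ln 2 ->
     H <= - (N * ln q + (INR n - N) * (ln (1 - q) - ln 2)) ->
     2 * H <= INR n * (C1 + C2) * ln 2
       - (N * (ln 2 + 2 * ln q) + (INR n - N) * (2 * ln (1 - q))) ->
     H <= INR n * V * ln 2) ->
  achievable C1 C2 Rt -> Rt <= V.
Proof.
move=> V0 ha hq hb ach; apply: Rnot_lt_le => ltVR.
have l2 := ln2_gt0.
have D0 : 0 < Rt * ln 2 + 1 by nra.
(* Chosen so that the Fano loss is at most half of the gap [n (Rt - V) ln 2]; [n >= 1] absorbs the
   additive 1. *)
pose eps := (Rt - V) * ln 2 / (2 * (Rt * ln 2 + 1)).
have eps0 : 0 < eps by apply: Rdiv_lt_0_compat; nra.
have epsE : eps * (Rt * ln 2 + 1) = (Rt - V) * ln 2 / 2.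
  by rewrite /eps; field; lra.
have [n [M [c [n1 [[_ hM] [e1 [e2 he]]]]]]] := ach _ eps0.
have M0 : 0 < INR M by apply: Rlt_le_trans hM; apply: exp_pos.
have M0' : (0 < M)%N by apply/ltP/INR_lt.
have lnM : INR n * Rt * ln 2 <= ln (INR M).
  by rewrite -[X in X <= _]ln_exp; apply: ln_le_mono => //; apply: exp_pos.
have [H [N [b1 b2 b3 b4]]] := code_converse M0' ha hq e1 e2.
have hH := hb n H N n1 b2 b3 b4.
have n1' : 1 <= INR n by rewrite -[X in X <= _]/(INR 1); apply: le_INR.
have nR0 : 0 <= INR n * Rt * ln 2 by apply: Rmult_le_pos; [nra | lra].
(* Fano is used as a lower bound on [H] by [(1 - eps) ln M - eps], so [ln M] may be replaced by its
   lower bound only when [1 - eps] is nonnegative. *)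
have e_half : eps < 1 by nra.
have b1' : ln (INR M) - H <= eps * (ln (INR M) + 1).
  by apply: Rle_trans b1 _; apply: Rmult_le_compat_r => //; lra.
have step : (1 - eps) * (INR n * Rt * ln 2) <= (1 - eps) * ln (INR M).
  by apply: Rmult_le_compat_l => //; lra.
have : INR n * ((Rt - V) * ln 2) <= eps * (INR n * (Rt * ln 2 + 1)) by nra.
rewrite (_ : eps * _ = INR n * (eps * (Rt * ln 2 + 1))); last by ring.
rewrite epsE; nra.
Qed.

(** * The binary entropy function *)

Lemma h2E q : 0 < q < 1 -> h2 q * ln 2 = - (q * ln q + (1 - q) * ln (1 - q)).
Proof.
have l2 := ln2_gt0.
move=> hq; rewrite /h2 /xlog2x /log2; case: Rle_dec => h; first by lra.
by case: Rle_dec => h'; first (by lra); field; lra.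
Qed.

Lemma xlog2x_ge p q : 0 <= p -> 0 < q -> - (xlog2x p * ln 2) <= - (p * ln q) + (q - p).
Proof.
have l2 := ln2_gt0.
move=> p0 q0; rewrite /xlog2x; case: Rle_dec => h.
  by rewrite (_ : p = 0); lra.
have p0' : 0 < p by lra.
have := ln_le_sub1 (Rdiv_lt_0_compat _ _ q0 p0'); rewrite ln_divE // => hl.
have := Rmult_le_compat_l _ _ _ p0 hl.
rewrite (_ : p * (q / p - 1) = q - p); last by field; lra.
rewrite /log2 (_ : p * (ln p / ln 2) * ln 2 = p * ln p); last by field; lra.
lra.
Qed.

Lemma h2_le_cross p q : 0 <= p <= 1 -> 0 < q < 1 ->
  h2 p * ln 2 <= - (p * ln q + (1 - p) * ln (1 - q)).
Proof.
move=> hp hq; rewrite /h2.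
have := @xlog2x_ge p q; have := @xlog2x_ge (1 - p) (1 - q); lra.
Qed.

(** Concavity without derivatives: the cross entropy relative to [q] is affine in [p] and is the
    tangent of [h2] at [q]. *)
Lemma h2_tangent p q : 0 <= p <= 1 -> 0 < q < 1 ->
  h2 p * ln 2 <= h2 q * ln 2 + (p - q) * (ln (1 - q) - ln q).
Proof. by move=> hp hq; have := h2_le_cross hp hq; rewrite (h2E hq); lra. Qed.

Lemma h2_half : h2 (1/2) = 1.
Proof.
have l2 := ln2_gt0.
apply: (Rmult_eq_reg_r (ln 2)); last lra.
rewrite h2E; last lra.
have -> : 1 - 1 / 2 = 1 / 2 by lra.
rewrite ln_divE ?ln_1; lra.
Qed.

Lemma h2_ge0 p : 0 <= p <= 1 -> 0 <= h2 p.
Proof.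
have l2 := ln2_gt0.
have xle x : 0 <= x <= 1 -> xlog2x x <= 0.
  move=> hx; rewrite /xlog2x; case: Rle_dec => h; first lra.
  have : ln x <= 0 by rewrite -ln_1; apply: ln_le_mono; lra.
  move=> lx; rewrite /log2 /Rdiv; have i0 := Rinv_0_lt_compat _ l2.
  suff : 0 <= x * (- ln x * / ln 2) by lra.
  by do 2! [apply: Rmult_le_pos; first lra]; lra.
by move=> hp; have := xle p hp; have := xle (1 - p) ltac:(lra); rewrite /h2; lra.
Qed.

Lemma h2_le1 p : 0 <= p <= 1 -> h2 p <= 1.
Proof.
have l2 := ln2_gt0.
move=> hp; have := @h2_tangent p (1/2) hp; rewrite h2_half.
have -> : 1 - 1 / 2 = 1 / 2 by lra.
by move=> h; apply: (Rmult_le_reg_r (ln 2)) => //; lra.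
Qed.

Lemma h2_mono p q : 0 <= p <= q -> 0 < q <= 1/2 -> h2 p <= h2 q.
Proof.
have l2 := ln2_gt0.
move=> hp hq; apply: (Rmult_le_reg_r (ln 2)) => //.
have := @h2_tangent p q.
have : ln q <= ln (1 - q) by apply: ln_le_mono; lra.
nra.
Qed.

(** * Random linear codes over the field with two elements *)

Section LinearCodes.
Import GRing.Theory.
Local Open Scope ring_scope.
Local Open Scope nat_scope.

Section FiniteField.
Variable F : finFieldType.

Definition indicator k (s : {set 'I_k}) : 'rV[F]_k := \row_i (i \in s)%:R.

Definition diag_set k (T : {set 'I_k}) : 'M[F]_k := diag_mx (indicator T).

Lemma mul_diag_set k (T : {set 'I_k}) (u : 'rV[F]_k) i :
  (u *m diag_set T)%R ord0 i = if i \in T then u ord0 i else 0%R.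
Proof. by rewrite mul_mx_diag !mxE; case: ifP => _; rewrite ?mulr1 ?mulr0. Qed.

(** Dependent columns are witnessed by a nonzero combination [lam], over which a union bound can
    run; a nonzero column of the cokernel provides it. *)
Lemma not_row_full_dual k r (A : 'M[F]_(k, r)) :
  ~~ row_full A -> exists2 lam : 'cV[F]_r, lam != 0%R & (A *m lam = 0)%R.
Proof.
move=> nA.
have : cokermx A != 0%R.
  rewrite -mxrank_eq0 mxrank_coker subn_eq0 -ltnNge ltn_neqAle rank_leq_col andbT.
  exact: nA.
have [[i j] /= hij _|h] := pickP (fun p => cokermx A p.1 p.2 != 0%R); last first.
  by case/eqP; apply/matrixP => i j; rewrite [RHS]mxE; apply/eqP; exact: (negbFE (h (i, j))).
exists (col j (cokermx A)).
  by apply: contraNneq hij => /colP/(_ i); rewrite !mxE => ->.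
by rewrite colE mulmxA mulmx_coker mul0mx.
Qed.

(* Adding [1_s * e_j / lam_j] to H, for s ranging over the subsets of T, moves
   H * lam through 2^|T| distinct values on T. *)
Lemma card_annihilator k r (T : {set 'I_k}) (lam : 'cV[F]_r) : lam != 0%R ->
  #|[set H : 'M[F]_(k, r) | (diag_set T *m H *m lam == 0)%R]| * 2 ^ #|T|
    <= #|{: 'M[F]_(k, r)}|.
Proof.
move=> lam0; have [j lamj] : exists j, lam j ord0 != 0%R.
  apply/existsP; apply: contraR lam0; rewrite negb_exists => /forallP h.
  by apply/eqP/colP => j; rewrite !mxE; apply/eqP; move: (h j); rewrite negbK.
rewrite -card_powerset -cardsX.
pose phi (p : 'M[F]_(k, r) * {set 'I_k}) :=
  (p.1 + (indicator p.2)^T *m ((lam j ord0)^-1 *: delta_mx ord0 j))%R.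
have phi_lam H s : (phi (H, s) *m lam = H *m lam + (indicator s)^T)%R.
  rewrite /phi mulmxDl -mulmxA -scalemxAl -rowE /=.
  suff -> : ((lam j ord0)^-1 *: row j lam = 1%:M)%R by rewrite mulmx1.
  by apply/matrixP => a b; rewrite !ord1 !mxE mulVf.
rewrite -(card_in_imset (f := phi)); first exact: max_card.
move=> [H s] [H' s']; rewrite !inE /= => /andP[/eqP h sT] /andP[/eqP h' sT'] e.
have supp (G : 'M[F]_(k, r)) i : (diag_set T *m G *m lam = 0)%R -> i \in T ->
    (G *m lam)%R i ord0 = 0%R.
  move=> G0 iT; transitivity ((diag_set T *m (G *m lam))%R i ord0).
    by rewrite mul_diag_mx [RHS]mxE [indicator _ _ _]mxE iT mul1r.
  by rewrite mulmxA G0 mxE.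
have es : s = s'.
  apply/setP => i; have := congr1 (fun G => (G *m lam)%R i ord0) e.
  rewrite !phi_lam !mxE.
  have [iT|iT] := boolP (i \in T); last first.
    have out (t : {set 'I_k}) : t \subset T -> i \in t = false.
      by move=> /subsetP tT; apply: contraNF iT => /tT.
    by rewrite !out.
  have := supp H i h iT; have := supp H' i h' iT; rewrite !mxE => -> ->; rewrite !add0r.
  by case: (i \in s); case: (i \in s') => // /eqP; rewrite ?(eq_sym 0%R) oner_eq0.
by move: e; rewrite /phi es /= => /addIr ->.
Qed.

(** Translating the kernel by a preimage of each syndrome gives pairwise disjoint sets of words. *)
Lemma card_kernel k m (H : 'M[F]_(k, m)) : (forall b : 'rV[F]_m, exists x, (x *m H)%R = b) ->
  #|[set x : 'rV[F]_k | (x *m H == 0)%R]| * #|F| ^ m <= #|F| ^ k.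
Proof.
move=> /fin_all_exists [s hs].
have -> : #|F| ^ m = #|[set: 'rV[F]_m]| by rewrite cardsT card_mx mul1n.
have -> : #|F| ^ k = #|{: 'rV[F]_k}| by rewrite card_mx mul1n.
rewrite -cardsX -(card_in_imset (f := fun p => (p.1 + s p.2)%R)); first exact: max_card.
move=> [x b] [x' b']; rewrite !inE /= => /andP[/eqP h _] /andP[/eqP h' _] e.
have eb : b = b'.
  by have := congr1 (fun z => (z *m H)%R) e; rewrite !mulmxDl h h' !add0r !hs.
by move: e; rewrite eb => /addIr ->.
Qed.
End FiniteField.

Local Notation F2 := 'F_2.

Lemma F2_cases (a : F2) : a = 0%R \/ a = 1%R.
Proof. by case: a => [[|[|?]] ?] //; [left | right]; apply: val_inj. Qed.

(** Union bound over fewer than [2 ^ r] vectors [lam], each annihilated on [T] by a fraction at most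
    [2 ^ - #|T|] of the matrices; [r < #|T|] leaves at most one half. *)
Lemma card_not_row_full k r (T : {set 'I_k}) : r < #|T| ->
  2 * #|[set H : 'M[F2]_(k, r) | ~~ row_full (diag_set F2 T *m H)%R]|
    <= #|{: 'M[F2]_(k, r)}|.
Proof.
move=> rT; set B := [set H | _]; set X := #|{: _}|.
suff h : #|B| * 2 ^ #|T| <= 2 ^ r * X.
  rewrite -(leq_pmul2l (expn_gt0 2 r : 0 < 2 ^ r)); apply: leq_trans h.
  by rewrite mulnCA mulnA -expnS mulnC leq_mul2l leq_exp2l // rT orbT.
pose K (lam : 'cV[F2]_r) := [set H : 'M[F2]_(k, r) | (diag_set F2 T *m H *m lam == 0)%R].
have sub : B \subset \bigcup_(lam | lam != 0%R) K lam.
  apply/subsetP => H; rewrite inE => /not_row_full_dual [lam l0 hl].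
  by apply/bigcupP; exists lam => //; rewrite inE hl.
have bound : #|B| <= \sum_(lam : 'cV[F2]_r | lam != 0%R) #|K lam|.
  apply: leq_trans (subset_leq_card sub) _.
  apply: (big_ind2 (fun (S : {set 'M[F2]_(k, r)}) n => #|S| <= n)) => //.
    by rewrite cards0.
  move=> S n S' n' hS hS'; apply: leq_trans (leq_add hS hS').
  by rewrite cardsU leq_subr.
apply: leq_trans (leq_mul bound (leqnn _)) _; rewrite big_distrl /=.
apply: (@leq_trans (\sum_(lam : 'cV[F2]_r | lam != 0%R) X)).
  by apply: leq_sum => lam l0; apply: card_annihilator.
rewrite sum_nat_const leq_mul2r; apply/orP; right.
apply: leq_trans (max_card _) _.
by rewrite card_mx muln1 card_Fp.
Qed.

Lemma exists_parity_matrix k r t : r < t ->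
  exists H : 'M[F2]_(k, r),
    2 * #|[set T : {set 'I_k} | (#|T| == t) && ~~ row_full (diag_set F2 T *m H)%R]|
      <= 'C(k, t).
Proof.
move=> rt.
have [H hH|hall] := pickP (fun H : 'M[F2]_(k, r) => 2 *
    #|[set T : {set 'I_k} | (#|T| == t) && ~~ row_full (diag_set F2 T *m H)%R]| <= 'C(k, t)).
  by exists H.
set X := #|{: 'M[F2]_(k, r)}|.
have X0 : 0 < X by apply/card_gt0P; exists 0%R.
pose bad (H : 'M[F2]_(k, r)) (T : {set 'I_k}) := ~~ row_full (diag_set F2 T *m H)%R.
(* Averaging: pairs of a matrix and a bad set are counted in both orders, with weight 2. The
   successor records that every matrix fails the bound strictly. *)
have : X * ('C(k, t)).+1 <= 'C(k, t) * X.
  apply: (@leq_trans (\sum_(H : 'M[F2]_(k, r)) \sum_(T : {set 'I_k} | (#|T| == t) && bad H T) 2)).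
    rewrite -sum_nat_const; apply: leq_sum => H _.
    by rewrite sum_nat_const mulnC -cardsE ltnNge; apply/negbT/hall.
  rewrite (exchange_big_dep (fun T : {set 'I_k} => #|T| == t)) /=; last by move=> H T _ /andP[].
  rewrite -[k in 'C(k, _)]card_ord -card_draws -sum_nat_const.
  rewrite [X in _ <= X](eq_bigl (fun T : {set 'I_k} => #|T| == t)); last by move=> T; rewrite inE.
  apply: leq_sum => T /eqP cT; rewrite sum_nat_const mulnC -cardsE.
  have rT : r < #|T| by rewrite cT.
  apply: leq_trans (card_not_row_full rT).
  rewrite leq_mul2l /=; apply: subset_leq_card; apply/subsetP => H.
  by rewrite !inE cT eqxx.
by rewrite mulnC leq_mul2r ltnn orbF => /eqP X0'; rewrite X0' in X0.
Qed.

Definition bits k (x : 'rV[F2]_k) (i : 'I_k) : bool := x ord0 i != 0%R.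

(* [p.1] is the set of positions with output 1 and [p.2] that with output 2. *)
Lemma covering_codes k t m : 2 * m < t -> t <= k ->
  exists (S : {set {set 'I_k} * {set 'I_k}})
    (x : {set 'I_k} * {set 'I_k} -> 'rV[F2]_k * 'rV[F2]_k) (A1 A2 : {set 'rV[F2]_k}),
  [/\ 'C(k, t) * 2 ^ (k - t) <= 2 * #|S|,
      #|A1| * 2 ^ m <= 2 ^ k, #|A2| * 2 ^ m <= 2 ^ k,
      forall p, p \in S -> (x p).1 \in A1 /\ (x p).2 \in A2
    & forall p, p \in S -> p.2 \subset ~: p.1 /\
        forall i, adder (bits (x p).1 i) (bits (x p).2 i) =
                  if i \in p.1 then None else Some (i \in p.2)].
Proof.
move=> mt tk; have mmt : m + m < t by rewrite addnn -mul2n.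
have [H hH] := exists_parity_matrix k mmt.
(* The [m + m] checks are split between the two codes. *)
pose H1 := lsubmx H; pose H2 := rsubmx H.
pose G := [set T : {set 'I_k} | (#|T| == t) && row_full (diag_set F2 T *m H)%R].
have cardG : 'C(k, t) <= 2 * #|G|.
  have e : #|G| +
      #|[set T : {set 'I_k} | (#|T| == t) && ~~ row_full (diag_set F2 T *m H)%R]| = 'C(k, t).
    rewrite -[k in 'C(k, _)]card_ord -card_draws.
    rewrite -[RHS](cardsID [set T : {set 'I_k} | row_full (diag_set F2 T *m H)%R]).
    by congr (_ + _); apply: eq_card => T; rewrite !inE // andbC.
  by move: hH; rewrite -e !mul2n -!addnn leq_add2r leq_add2l.
have [T0 T0G] : exists T0, T0 \in G.
  apply/card_gt0P; have : 0 < 'C(k, t) by rewrite bin_gt0.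
  by move=> /leq_trans/(_ cardG); rewrite muln_gt0.
(* Full rank on [T] means that a word supported in [T] can have any pair of syndromes. *)
have surj (T : {set 'I_k}) (b1 b2 : 'rV[F2]_m) : T \in G ->
    exists u, (u *m diag_set F2 T *m H1 = b1 /\ u *m diag_set F2 T *m H2 = b2)%R.
  rewrite inE => /andP[_ hT].
  have /submxP [u hu] := submx_full (row_mx b1 b2) hT.
  exists u; move: hu; rewrite mulmxA -{1}(hsubmxK H) mul_mx_row => /eq_row_mx [-> ->].
  by [].
have K1 : #|[set x : 'rV[F2]_k | (x *m H1 == 0)%R]| * 2 ^ m <= 2 ^ k.
  have := @card_kernel F2 k m H1; rewrite card_Fp //; apply=> b.
  by have [u [e _]] := surj T0 b 0%R T0G; exists (u *m diag_set F2 T0)%R.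
have K2 : #|[set x : 'rV[F2]_k | (x *m H2 == 0)%R]| * 2 ^ m <= 2 ^ k.
  have := @card_kernel F2 k m H2; rewrite card_Fp //; apply=> b.
  by have [u [_ e]] := surj T0 0%R b T0G; exists (u *m diag_set F2 T0)%R.
pose S := [set p : {set 'I_k} * {set 'I_k} | (p.1 \in G) && (p.2 \subset ~: p.1)].
have : forall p, exists x : 'rV[F2]_k * 'rV[F2]_k, p \in S ->
    [/\ (x.1 *m H1 = 0)%R, (x.2 *m H2 = 0)%R & forall i, adder (bits x.1 i) (bits x.2 i) =
                  if i \in p.1 then None else Some (i \in p.2)].
  move=> [T s]; have [pS|] := boolP ((T, s) \in S); last by exists (0, 0)%R.
  move: pS; rewrite inE /= => /andP[TG sT].
  (* The inputs must equal [s] off [T] and be complementary on [T], that is, differ by the indicator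
     of [T]. The word supported in [T] cancels the syndromes of both candidates at once, leaving [s]
     unchanged off [T]. *)
  have [u [e1 e2]] := surj T (- (indicator F2 s *m H1))%R
    (- ((indicator F2 s + indicator F2 T) *m H2))%R TG.
  pose x1 := (indicator F2 s + u *m diag_set F2 T)%R.
  exists (x1, x1 + indicator F2 T)%R => _; split => /=.
  - by rewrite mulmxDl e1 subrr.
  - by rewrite /x1 -addrA (addrC (_ *m _)%R) addrA mulmxDl e2 subrr.
  move=> i; rewrite /bits; have -> : (x1 + indicator F2 T)%R ord0 i = (x1 ord0 i + (i \in T)%:R)%R.
    by rewrite !mxE.
  have [iT|iT] := boolP (i \in T).
    by case: (F2_cases (x1 ord0 i)) => ->.
  have -> : x1 ord0 i = (i \in s)%:R%R.
    by rewrite mxE mul_diag_set (negbTE iT) addr0 mxE.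
  by case: (i \in s).
move=> /fin_all_exists [x hx].
exists S, x, [set x : 'rV[F2]_k | (x *m H1 == 0)%R], [set x : 'rV[F2]_k | (x *m H2 == 0)%R].
split=> //.
- have -> : #|S| = #|G| * 2 ^ (k - t).
    rewrite -sum1_card (eq_bigl (fun p : {set 'I_k} * {set 'I_k} =>
      (p.1 \in G) && (p.2 \subset ~: p.1))); last first.
      by move=> p; rewrite inE.
    rewrite -(pair_big_dep (mem G) (fun T s : {set 'I_k} => s \subset ~: T) (fun _ _ => 1)) /=.
    rewrite -sum_nat_const; apply: eq_bigr => T; rewrite inE => /andP[/eqP cT _].
    rewrite sum1_card.
    have -> : k - t = #|~: T| by rewrite -cT -[X in X - _]card_ord -(cardsC T) addKn.
    by rewrite -card_powerset; apply: eq_card => s; rewrite !inE.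
  by rewrite mulnA leq_mul2r cardG orbT.
- by move=> p /hx [h1 h2 _]; rewrite !inE h1 h2 eqxx.
- move=> p pS; have [_ _ h] := hx p pS; split=> //.
  by move: pS; rewrite inE => /andP[].
Qed.
End LinearCodes.

(** * Binomial coefficients, entropy and logarithmic losses *)

Lemma exp_le_mono x y : x <= y -> exp x <= exp y.
Proof. by move=> [/exp_increasing /Rlt_le | ->] //; apply: Rle_refl. Qed.

Lemma nat_ceil x : -1 < x -> exists M : nat, INR M - 1 < x <= INR M.
Proof.
move=> x1; have [N [_ hN]] : exists N, 0 <= 0 /\ x <= INR N.
  have [N hN] := INR_unbounded x; exists N; lra.
elim: N hN => [|N IH] hN; first by exists 0%N; rewrite /= in hN *; lra.
have [/IH //|hx] := Rle_lt_dec x (INR N).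
by exists N.+1; rewrite S_INR in hN *; lra.
Qed.

Lemma ln_INR_exp a b : (0 < a)%N -> ln (INR (a ^ b)) = INR b * ln (INR a).
Proof.
move=> a0; elim: b => [|b IH]; first by rewrite /= ln_1; ring.
rewrite expnS mult_INR ln_mult ?IH; first last.
- by apply/lt_0_INR/ltP; rewrite expn_gt0 a0.
- by apply/lt_0_INR/ltP.
by rewrite [INR b.+1]S_INR; ring.
Qed.

Lemma ln_INR_pow2 k : ln (INR (2 ^ k)) = INR k * ln 2.
Proof. by rewrite ln_INR_exp. Qed.

(** Cross-multiplied form of the fact that [t ^ j / j!] is largest at [j = t]. *)
Lemma fact_exp_le t j : (t`! * t ^ j <= j`! * t ^ t)%N.
Proof.
have [le_tj|/ltnW le_jt] := leqP t j.
  rewrite -(subnK le_tj); elim: (j - t)%N => [|d IH] //.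
  rewrite addSn factS expnS mulnCA -mulnA leq_mul //.
  by rewrite (leq_trans (leq_addl d t)).
suff h d : (j + d <= t -> (j + d)`! <= j`! * t ^ d)%N.
  rewrite -{1}(subnKC le_jt) -{4}(subnK le_jt) expnD mulnA leq_mul //.
  by apply: h; rewrite subnKC.
elim: d => [|d IH] hd; first by rewrite addn0 muln1.
rewrite addnS factS expnS mulnCA leq_mul //; first by rewrite -addnS.
by apply: IH; apply: ltnW; rewrite -addnS.
Qed.

(** The binomial law with success probability [t / k] has its mode at [t]. *)
Lemma bin_exp_le k t j : (t <= k)%N -> (j <= k)%N ->
  ('C(k, j) * (t ^ j * (k - t) ^ (k - j)) <= 'C(k, t) * (t ^ t * (k - t) ^ (k - t)))%N.
Proof.
move=> tk jk; rewrite -(leq_pmul2r (_ : 0 < t`! * (k - t)`!)%N); last first.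
  by rewrite muln_gt0 !fact_gt0.
rewrite [leqRHS]mulnAC (bin_fact tk) -(bin_fact jk) -!mulnA leq_mul2l; apply/orP; right.
have := leq_mul (fact_exp_le t j) (fact_exp_le (k - t) (k - j)).
congr (_ <= _)%N; first by rewrite mulnACA mulnC -mulnA.
by rewrite mulnACA -mulnA.
Qed.

(** Expanding [((k - t) + t) ^ k] gives [k + 1] terms, each at most the one at the mode. *)
Lemma exp_le_bin k t : (t <= k)%N ->
  (k ^ k <= k.+1 * ('C(k, t) * (t ^ t * (k - t) ^ (k - t))))%N.
Proof.
move=> tk; rewrite -{1}(subnK tk) expnDn -[X in (_ <= X * _)%N]card_ord -sum_nat_const.
apply: leq_sum => j _; rewrite [(_ ^ _ * t ^ j)%N]mulnC.
by apply: bin_exp_le => //; rewrite -ltnS.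
Qed.

Lemma ln_bin_ge k t : (0 < t < k)%N ->
  INR k * (h2 (INR t / INR k) * ln 2) - ln (INR k + 1) <= ln (INR 'C(k, t)).
Proof.
move=> /andP[t0 tk].
have pos a : (0 < a)%N -> 0 < INR a by move=> a0; apply/lt_0_INR/ltP.
have k0 := pos _ (ltn_trans t0 tk); have t0' := pos _ t0.
have s0 : (0 < k - t)%N by rewrite subn_gt0.
have sE : INR (k - t) = INR k - INR t by rewrite minus_INR //; apply/leP/ltnW.
have s0' := pos _ s0.
have c0 : (0 < 'C(k, t))%N by rewrite bin_gt0 ltnW.
have /leP/le_INR := exp_le_bin (ltnW tk).
move=> /(ln_le_mono _) => /(_ (pos _ _)); rewrite expn_gt0 (ltn_trans t0 tk) => /(_ isT).
rewrite !mult_INR !ln_mult ?ln_INR_exp ?(ltn_trans t0 tk) //; try by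
  repeat apply: Rmult_lt_0_compat; apply: pos; rewrite ?expn_gt0 ?t0 ?s0.
rewrite S_INR => h.
rewrite h2E; last first.
  split; first exact: Rdiv_lt_0_compat.
  apply: (Rmult_lt_reg_r (INR k)) => //; rewrite /Rdiv Rmult_assoc Rinv_l; lra.
have -> : 1 - INR t / INR k = INR (k - t) / INR k by rewrite sE; field; lra.
rewrite !ln_divE // (_ : INR k * _ = INR k * ln (INR k) - INR t * ln (INR t)
  - INR (k - t) * ln (INR (k - t))); last by rewrite sE; field; lra.
lra.
Qed.

Lemma log_linear kappa B : 0 < kappa -> exists N : nat, forall n : nat,
  (N <= n)%N -> B + ln (INR n + 1) <= kappa * INR n.
(* Half of [kappa] absorbs the logarithm, the other half the constants. *)
Proof.
move=> k0; pose e := kappa / 2; have e0 : 0 < e by rewrite /e; lra.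
have [N hN] := INR_unbounded ((B + e - 1 - ln e) / e).
exists N => n /leP/le_INR hn.
have n0 := pos_INR n.
have := @ln_le_sub1 (e * (INR n + 1)); rewrite ln_mult //; last lra.
move=> /(_ ltac:(nra)) h.
have : B + e - 1 - ln e < e * INR n.
  have -> : B + e - 1 - ln e = e * ((B + e - 1 - ln e) / e) by field; lra.
  by apply: Rmult_lt_compat_l; lra.
rewrite (_ : kappa = e + e); [lra | rewrite /e; lra].
Qed.

(** * Achievability *)

Lemma achievable_of_covering n k t m C Rt :
  (0 < n)%N -> (k <= n)%N -> (2 * m < t)%N -> (t <= k)%N ->
  INR k - INR m <= INR n * C ->
  INR n * Rt * ln 2 <= ln (INR 'C(k, t)) + (INR k - INR t) * ln 2 - ln 2 ->
  achievable C C Rt.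
Proof.
move=> n0 kn mt tk hC hR eps eps0.
have [S [x [A1 [A2 [cS cA1 cA2 inA xS]]]]] := covering_codes mt tk.
have l2 := ln2_gt0.
have [M hM] : exists M : nat, INR M - 1 < Rpower 2 (INR n * Rt) <= INR M.
  apply: nat_ceil; have : 0 < Rpower 2 (INR n * Rt) by apply: exp_pos.
  lra.
have M0 : (0 < M)%N.
  apply/ltP/INR_lt/(Rlt_le_trans _ _ _ _ (proj2 hM)); exact: exp_pos.
have c0 : (0 < 'C(k, t))%N by rewrite bin_gt0.
have pos a : (0 < a)%N -> 0 < INR a by move=> a0; apply/lt_0_INR/ltP.
have S0 : (0 < #|S|)%N.
  have : (0 < 2 * #|S|)%N by apply: leq_trans cS; rewrite muln_gt0 c0 expn_gt0.
  by rewrite muln_gt0.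
(* The term [- ln 2] in the rate hypothesis pays for the half of the sets [T] that may be lost. *)
have MS : (M <= #|S|)%N.
  rewrite -ltnS; apply/ltP/INR_lt; rewrite S_INR.
  suff : Rpower 2 (INR n * Rt) <= INR #|S| by lra.
  rewrite -[X in _ <= X]exp_ln; last exact: pos.
  apply: exp_le_mono; apply: Rle_trans hR _.
  have /leP/le_INR/(ln_le_mono _) := cS.
  rewrite !mult_INR => /(_ (Rmult_lt_0_compat _ _ (pos _ c0) (pos _ _))).
  rewrite expn_gt0 => /(_ isT); rewrite !ln_mult ?ln_INR_pow2; try exact: pos.
  - rewrite minus_INR; last exact/leP.
    rewrite (_ : INR 2 = 2) //=; lra.
  - by apply: pos; rewrite expn_gt0.
pose e w := nth (set0, set0) (enum S) w.
have eS w : (w < M)%N -> e w \in S.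
  by move=> wM; rewrite -mem_enum mem_nth // -cardE (leq_trans wM).
pose f1 w : nat := pickle (x (e w)).1; pose f2 w : nat := pickle (x (e w)).2.
(* Positions from [k] on carry the input 0 at both relays. *)
pose g (v l : nat) : bool :=
  if unpickle v is Some z then
    if insub l is Some i then @bits k z i else false
  else false.
have gE (z : 'rV['F_2]_k) (i : 'I_k) : g (pickle z) i = bits z i.
  by rewrite /g pickleK valK.
pose out w := output n (mkCode f1 f2 g g (fun _ => 0%N)) w.
have out_inj : {in [pred w | (w < M)%N] &, injective out}.
  move=> w w' wM w'M; rewrite /out /output list_seqE => /eq_in_map eo.
  have ea i : adder (bits (x (e w)).1 i) (bits (x (e w)).2 i) =
              adder (bits (x (e w')).1 i) (bits (x (e w')).2 i).
    have := eo i; rewrite mem_iota add0n (leq_trans (ltn_ord i) kn) => /(_ isT) /=.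
    by rewrite /f1 /f2 !gE; do 4! case: (bits _ i).
  have [d h] := xS _ (eS _ wM); have [d' h'] := xS _ (eS _ w'M).
  have {ea} ea i := etrans (esym (h i)) (etrans (ea i) (h' i)).
  have e1 : (e w).1 = (e w').1.
    by apply/setP => i; have := ea i; case: (i \in _); case: (i \in _).
  have e2 : (e w).2 = (e w').2.
    apply/setP => i; have := ea i; rewrite -e1; case: ifP => [i1 _|_ [] //].
    have notin (s : {set 'I_k}) : s \subset ~: (e w).1 -> i \in s = false.
      by move=> /subsetP/(_ i); rewrite inE i1 => h0; apply/negP => /h0.
    by rewrite !notin // e1.
  have : e w = e w' by rewrite (surjective_pairing (e w)) e1 e2 -surjective_pairing.
  move=> /eqP; rewrite nth_uniq ?enum_uniq -?cardE ?(leq_trans _ MS) // => /eqP.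
  by [].
pose outs := [seq out w | w <- iota 0 M].
(* The decoder looks the output up in the list of all outputs, which are pairwise distinct, so there
   is no error. *)
pose c := mkCode f1 f2 g g (fun l => index (l : seq nat) outs).
exists n, M, c.
have entropy_le (A : {set 'rV['F_2]_k}) (h : nat -> 'rV['F_2]_k) :
    (#|A| * 2 ^ m <= 2 ^ k)%N -> (forall w, (w < M)%N -> h w \in A) ->
    entropy_unif M (fun w => pickle (h w)) <= INR n * C.
  move=> cA hA; apply: (Rmult_le_reg_r (ln 2)) => //; rewrite entropy_unifE //.
  apply: Rle_trans (entropy_image_le (unif_gt0 M0)
    (f1 := fun w : 'I_M => h w) _) _; first by move=> w w' ->.
  apply: Rle_trans (entropy_le_ln_card (unif_gt0 M0) (unif_sum1 M0) (A := A) _) _.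
    by move=> w; apply: hA.
  have A0 : 0 < INR #|A| by apply/pos/card_gt0P; exists (h 0%N); apply: hA.
  have p0 : 0 < INR (2 ^ m) by apply: pos; rewrite expn_gt0.
  have /leP/le_INR := cA; rewrite mult_INR => /(ln_le_mono (Rmult_lt_0_compat _ _ A0 p0)).
  rewrite ln_mult // !ln_INR_pow2; nra.
split; first exact/leP.
split; first exact: hM.
split; first by apply: (entropy_le A1 (fun w => (x (e w)).1)) => // w /eS/inA [].
split; first by apply: (entropy_le A2 (fun w => (x (e w)).2)) => // w /eS/inA [].
rewrite perrE eq_card0 /=; first by rewrite /Rdiv Rmult_0_l; lra.
move=> w; rewrite !inE; apply/negbTE; rewrite negbK; apply/eqP.
have -> : output n c w = nth [::] outs w.
  by rewrite (nth_map 0%N) ?size_iota // nth_iota.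
rewrite index_uniq ?size_map ?size_iota //.
rewrite map_inj_in_uniq ?iota_uniq // => a b; rewrite !mem_iota !add0n /= => aM bM.
exact: out_inj.
Qed.

Lemma achievable_0 C : 0 <= C -> achievable C C 0.
Proof.
move=> C0 eps eps0; exists 1%N, 1%N,
  (mkCode id id (fun _ _ => false) (fun _ _ => false) (fun _ => 0%N)).
have H0 : entropy_unif 1 id = 0.
  by rewrite /entropy_unif /cnt /= /log2 Rdiv_1_r ln_1; lra.
rewrite /= H0 Rmult_0_r Rpower_O; last lra.
by split=> //; split; [lra | split; [lra | split; [lra | rewrite /perr /=; lra]]].
Qed.

Lemma achievable_lt_2C C Rt : 0 < C <= 3 / 4 -> Rt < 2 * C -> achievable C C Rt.
Proof.
move=> hC hR; have l2 := ln2_gt0.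
(* The rate gap in nats per unit of link load [n C]. *)
pose kap := (2 * C - Rt) / C * ln 2.
have kap0 : 0 < kap by apply: Rmult_lt_0_compat => //; apply: Rdiv_lt_0_compat; lra.
have [N hN] := @log_linear (kap / 2) (4 * ln 2) ltac:(lra).
(* Half of the [k] used positions have output 1: about 3/2 bits per used position, for a link load
   [k - m = 3 m + 2], about 3/4 per used position. Then [n] is the least length that affords this
   load. *)
pose m := N; pose t := (2 * m + 1)%N; pose k := (2 * t)%N.
have tE : INR t = 2 * INR m + 1 by rewrite /t plus_INR mult_INR /=; ring.
have kE : INR k = 2 * INR t by rewrite /k mult_INR /=; ring.
have m0 := pos_INR m.
have [n [n1 n2]] := @nat_ceil ((3 * INR m + 2) / C)
  ltac:(have := Rdiv_lt_0_compat (3 * INR m + 2) C; lra).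
have nC1 : INR n * C < 3 * INR m + 2 + C.
  have -> : 3 * INR m + 2 + C = ((3 * INR m + 2) / C + 1) * C by field; lra.
  by apply: Rmult_lt_compat_r; lra.
have nC2 : 3 * INR m + 2 <= INR n * C.
  rewrite {1}(_ : 3 * INR m + 2 = (3 * INR m + 2) / C * C); last by field; lra.
  by apply: Rmult_le_compat_r; lra.
(* Here [C <= 3 / 4] enters: [n] is at least 4/3 of [3 m + 2], which exceeds [4 m + 2]. *)
have kn : (k <= n)%N.
  rewrite -ltnS; apply/ltP/INR_lt; rewrite S_INR kE tE; nra.
have t0 : (0 < t)%N by rewrite /t addn1.
apply: (@achievable_of_covering n k t m) => //.
- by apply: leq_trans kn; rewrite /k muln_gt0.
- by rewrite /t addn1.
- by rewrite /k mul2n -addnn leq_addr.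
- by rewrite kE tE; lra.
have tk : (0 < t < k)%N by rewrite t0 /k mul2n -addnn -[X in (X < _)%N]addn0 ltn_add2l.
have := ln_bin_ge tk; rewrite (_ : INR t / INR k = 1 / 2) ?h2_half; last first.
  by rewrite kE; field; lra.
have hlog : 4 * ln 2 + ln (INR k + 1) <= kap / 2 * INR k.
  by apply: hN; rewrite /k /t /m addn1 mulnS !mulnA (leq_trans _ (leq_addl _ _)) ?leq_pmull.
have nkap : kap * (3 * INR m + 2) <= INR n * (2 * C - Rt) * ln 2.
  rewrite (_ : INR n * (2 * C - Rt) * ln 2 = kap * (INR n * C)); last by rewrite /kap; field; lra.
  by apply: Rmult_le_compat_l; lra.
have hk : kap / 2 * INR k <= kap * (3 * INR m + 2) by rewrite kE tE; nra.
have nC1' : INR n * (2 * C) * ln 2 <= (6 * INR m + 4 + 2 * C) * ln 2.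
  by apply: Rmult_le_compat_r; lra.
have hC' : 2 * C * ln 2 <= 2 * ln 2 by apply: Rmult_le_compat_r; lra.
move: hlog; rewrite kE tE => hlog hbin; move: hk; rewrite kE tE; lra.
Qed.

(** All positions are used, with [m] near [n (1 - C)] and [t] near [n q]; [2 * (1 - C) <= q] is the
    room needed for [2 m < t]. Since [q < 1 / 2], the rounded [t / n] stays where [h2] increases. *)
Lemma achievable_lt_output C q Rt : 1 / 3 <= q < 1 / 2 -> 2 * (1 - C) <= q ->
  Rt < h2 q + 1 - q -> achievable C C Rt.
Proof.
move=> hq hC hR; have l2 := ln2_gt0.
have [N hN] := @log_linear ((h2 q + 1 - q - Rt) * ln 2) (5 * ln 2) ltac:(nra).
have [N' hN'] := INR_unbounded (4 / (1 / 2 - q)).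
pose n := (N + N').+1.
have n0 : (0 < n)%N by [].
have nR : 0 < INR n by apply/lt_0_INR/ltP.
have hlog : 5 * ln 2 + ln (INR n + 1) <= (h2 q + 1 - q - Rt) * ln 2 * INR n.
  by apply: hN; rewrite /n ltnW // ltnS leq_addr.
have n_large : INR n * q + 4 <= INR n / 2.
  have : 4 / (1 / 2 - q) <= INR n.
    apply: Rle_trans (Rlt_le _ _ hN') _; apply/le_INR/leP.
    by rewrite /n ltnW // ltnS leq_addl.
  move=> /(Rmult_le_compat_r (1 / 2 - q) _ _ ltac:(lra)).
  by rewrite /Rdiv Rmult_assoc Rinv_l; lra.
(* The maximum with 0 covers [C > 1]. Rounding gives [2 m < n q + 2], hence the shift by 3 in
   [t]. *)
have [m [m1 m2]] := @nat_ceil (Rmax 0 (INR n * (1 - C)))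
  ltac:(have := Rmax_l 0 (INR n * (1 - C)); lra).
have [t [t1 t2]] := @nat_ceil (INR n * q + 3) ltac:(nra).
have nq0 : 0 < INR n * q by nra.
have mt2 : 2 * INR m < INR t.
  have : Rmax 0 (INR n * (1 - C)) <= INR n * q / 2 by apply: Rmax_lub; nra.
  lra.
have mt : (2 * m < t)%N by apply/ltP/INR_lt; rewrite mult_INR /=; lra.
have tn : (t < n)%N by apply/ltP/INR_lt; lra.
have t0 : (0 < t)%N by apply: leq_ltn_trans mt.
apply: (@achievable_of_covering n n t m) => //; first exact: ltnW.
  by have := Rmax_r 0 (INR n * (1 - C)); lra.
have tn' : (0 < t < n)%N by rewrite t0.
have := ln_bin_ge tn'.
have hqt : h2 q <= h2 (INR t / INR n).
  apply: h2_mono; split; try lra.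
  - by apply: (Rmult_le_reg_r (INR n)) => //; rewrite /Rdiv Rmult_assoc Rinv_l; lra.
  - by apply: Rdiv_lt_0_compat => //; apply/lt_0_INR/ltP.
  - by apply: (Rmult_le_reg_r (INR n)) => //; rewrite /Rdiv Rmult_assoc Rinv_l; lra.
have : INR n * (h2 q * ln 2) <= INR n * (h2 (INR t / INR n) * ln 2).
  by apply: Rmult_le_compat_l; [lra | apply: Rmult_le_compat_r => //; lra].
nra.
Qed.

(** * Optimization over p and the capacity *)

Lemma is_lub_of_lt (E : R -> Prop) V :
  (forall x, E x -> x <= V) -> (forall x, x < V -> E x) -> is_lub E V.
Proof.
move=> ub lt; split=> // b hb; apply: Rnot_lt_le => bV.
by have := hb ((b + V) / 2) (lt ((b + V) / 2) ltac:(lra)); lra.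
Qed.

Lemma Rmin4_le a b c d : [/\ Rmin (Rmin a b) (Rmin c d) <= a,
  Rmin (Rmin a b) (Rmin c d) <= b, Rmin (Rmin a b) (Rmin c d) <= c &
  Rmin (Rmin a b) (Rmin c d) <= d].
Proof.
have := Rmin_l (Rmin a b) (Rmin c d); have := Rmin_r (Rmin a b) (Rmin c d).
have := Rmin_l a b; have := Rmin_r a b; have := Rmin_l c d; have := Rmin_r c d.
by split; lra.
Qed.

Lemma Rmin3_le a b c : [/\ Rmin (Rmin a b) c <= a, Rmin (Rmin a b) c <= b &
  Rmin (Rmin a b) c <= c].
Proof.
have := Rmin_l (Rmin a b) c; have := Rmin_r (Rmin a b) c.
by have := Rmin_l a b; have := Rmin_r a b; split; lra.
Qed.

Lemma p1_bounds : 1 / 3 <= p1 < 1 / 2 /\ (1 + sqrt 2) * p1 = 1.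
Proof.
have s2 : sqrt 2 * sqrt 2 = 2 by apply: sqrt_sqrt; lra.
have s0 := sqrt_pos 2.
have e : (1 + sqrt 2) * p1 = 1 by rewrite /p1; field; lra.
split=> //; split; nra.
Qed.

(** At [p = 1 / 2] every term is at least [2 * C], because [h2 (1 / 2) = 1] and [C <= 3 / 4]. The
    converse is the cut around the two links. *)
Lemma diamond_small C : 0 <= C <= 3 / 4 ->
  [/\ is_max_half (lower_fun C) (2 * C), is_max_half (upper_fun C) (2 * C)
    & is_lub (achievable C C) (2 * C)].
Proof.
move=> hC; split.
- split; last first.
    by move=> p _; have [] := Rmin4_le (2 * C) (C + h2 p) (h2 p + 1 - p) (C + h2 p - p / 2).
  exists (1 / 2); split; first lra.
  by rewrite /lower_fun h2_half /Rmin; do ! case: Rle_dec; lra.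
- split.
    exists (1 / 2); split; first lra.
    by rewrite /upper_fun h2_half /Rmin; do ! case: Rle_dec; lra.
  move=> p hp; have := @h2_le1 p ltac:(lra).
  by have [] := Rmin3_le (2 * C - 1 + h2 p) (C + h2 p) (h2 p + 1 - p); rewrite /upper_fun; lra.
have ub x : achievable C C x -> x <= 2 * C.
  apply: (@achievable_le _ _ _ _ (1 / 2) (1 / 2)); try lra.
  by move=> n H N _; lra.
(* For [C = 0] the supremum is attained, by the single-message code. *)
have [C0|C0] : C = 0 \/ 0 < C by lra.
  split=> // b; rewrite C0 Rmult_0_r; apply; apply: achievable_0; lra.
by apply: is_lub_of_lt => // x; apply: achievable_lt_2C; lra.
Qed.

(** [1 / 3] maximizes [h2 p + 1 - p]. At [2 * (1 - C)] this function crosses both [C + h2 p - p / 2]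
    and [2 * C - 1 + h2 p], which increase up to there. *)
Lemma diamond_large C q : 1 / 3 <= q <= p1 -> 2 * (1 - C) <= q ->
  q = 1 / 3 \/ q = 2 * (1 - C) ->
  [/\ is_max_half (lower_fun C) (h2 q + 1 - q), is_max_half (upper_fun C) (h2 q + 1 - q)
    & is_lub (achievable C C) (h2 q + 1 - q)].
Proof.
move=> hq hC hq'; have l2 := ln2_gt0.
have [p1b p1e] := p1_bounds.
have q01 : 0 < q < 1 by lra.
have h1 := @h2_le1 q ltac:(lra).
(* The slope of [h2] at [q], in nats: [1 / 3 <= q] makes it at most [ln 2], and [q <= p1], that is
   [sqrt 2 * q <= 1 - q], makes it at least half of [ln 2]. *)
pose L := ln (1 - q) - ln q.
have L_le : L <= ln 2.
  by have := @ln_le_mono (1 - q) (2 * q) ltac:(lra) ltac:(lra); rewrite ln_mult /L; lra.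
have L_ge : ln 2 <= 2 * L.
  have s0 := sqrt_pos 2; have s2 : sqrt 2 * sqrt 2 = 2 by apply: sqrt_sqrt; lra.
  have := @ln_le_mono (2 * (q * q)) ((1 - q) * (1 - q)) ltac:(nra).
  have hs : (1 + sqrt 2) * q <= 1 by nra.
  by move=> /(_ ltac:(nra)); rewrite !ln_mult /L; try nra.
have L_third : q = 1 / 3 -> L = ln 2.
  move=> e; rewrite /L e (_ : 1 - 1 / 3 = 2 * (1 / 3)); last by field.
  by rewrite ln_mult; lra.
have below p : 0 <= p <= 1 / 2 -> (q <= p \/ q = 1 / 3) -> h2 p + 1 - p <= h2 q + 1 - q.
  move=> hp h; have := @h2_tangent p q ltac:(lra) q01; rewrite -/L => ht.
  apply: (Rmult_le_reg_r (ln 2)) => //.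
  by case: h => [h|/L_third h]; nra.
have above p : 0 <= p <= q -> h2 p - p / 2 <= h2 q - q / 2.
  move=> hp; have := @h2_tangent p q ltac:(lra) q01; rewrite -/L => ht.
  by apply: (Rmult_le_reg_r (ln 2)) => //; nra.
split.
- split.
    exists q; split; first lra.
    by rewrite /lower_fun /Rmin; do ! case: Rle_dec; lra.
  move=> p hp; rewrite /lower_fun.
  have [_ _ b3 b4] := Rmin4_le (2 * C) (C + h2 p) (h2 p + 1 - p) (C + h2 p - p / 2).
  case: (Rle_lt_dec q p) => [qp|pq]; first by have := below p hp (or_introl qp); lra.
  case: hq' => e; first by have := below p hp (or_intror e); lra.
  by have := above p ltac:(lra); lra.
- split.
    exists q; split; first lra.
    by rewrite /upper_fun /Rmin; do ! case: Rle_dec; lra.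
  move=> p hp; rewrite /upper_fun.
  have [b1 _ b3] := Rmin3_le (2 * C - 1 + h2 p) (C + h2 p) (h2 p + 1 - p).
  case: (Rle_lt_dec q p) => [qp|pq]; first by have := below p hp (or_introl qp); lra.
  case: hq' => e; first by have := below p hp (or_intror e); lra.
  by have := @h2_mono p q ltac:(lra) ltac:(lra); lra.
apply: is_lub_of_lt => x; last by apply: achievable_lt_output; lra.
(* The smaller root of [2 * a * (1 - a) = q]. *)
pose a := (1 - sqrt (1 - 2 * q)) / 2.
have s0 : 0 < sqrt (1 - 2 * q) by apply: sqrt_lt_R0; lra.
have s2 : sqrt (1 - 2 * q) * sqrt (1 - 2 * q) = 1 - 2 * q by apply: sqrt_sqrt; lra.
have s1 : sqrt (1 - 2 * q) < 1 by nra.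
apply: (@achievable_le _ _ _ _ a q).
- by have := @h2_ge0 q ltac:(lra); lra.
- by rewrite /a; lra.
- by rewrite /a; nra.
move=> n H N _ _ hY hD.
rewrite (_ : INR n * _ * ln 2 = INR n * (h2 q * ln 2) + INR n * (1 - q) * ln 2); last by ring.
have hE := h2E q01.
have lq : ln (1 - q) = L + ln q by rewrite /L; ring.
rewrite hE; rewrite lq in hY hD *.
(* In [N] the output bound has slope [L - ln 2], at most 0 and equal to 0 at [q = 1 / 3]; the
   auxiliary bound on [2 * H] has slope [2 * L - ln 2], at least 0. Each is used on the side of
   [n q] where it stays below its value at [n q]. *)
have [hN|[hN e]] : (INR n * q <= N \/ q = 1 / 3) \/ (N < INR n * q /\ q = 2 * (1 - C)).
  case: (Rle_lt_dec (INR n * q) N) => [?|?]; first by left; left.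
  by case: hq' => ?; [left; right | right].
- have : 0 <= (N - INR n * q) * (ln 2 - L).
    case: hN => [hN|/L_third ->]; last by lra.
    by apply: Rmult_le_pos; lra.
  lra.
- have : 0 <= (INR n * q - N) * (2 * L - ln 2) by apply: Rmult_le_pos; lra.
  rewrite (_ : C + C = 2 - q) in hD; last by lra.
  lra.
Qed.

Theorem theorem7 (C : R) (hC : 0 <= C)
  (hrange : C <= 3 / 4 \/ 1 - p1 / 2 <= C) :
  exists V : R,
    is_max_half (lower_fun C) V /\
    is_max_half (upper_fun C) V /\
    is_lub (achievable C C) V.
Proof.
case: hrange => hC'.
  by have [h1 h2 h3] := @diamond_small C (conj hC hC'); exists (2 * C).
(* The unconstrained maximizer, moved right to the crossing point when that lies beyond it; the
   bound on [C] keeps it at most [p1]. *)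
pose q := Rmax (1 / 3) (2 * (1 - C)).
have [p1b _] := p1_bounds.
have hq : 1 / 3 <= q <= p1 by split; [apply: Rmax_l | apply: Rmax_lub; lra].
have hq' : q = 1 / 3 \/ q = 2 * (1 - C).
  by rewrite /q /Rmax; case: Rle_dec => _; [right | left].
have [m1 m2 m3] := diamond_large hq (Rmax_r _ _) hq'.
by exists (h2 q + 1 - q).
Qed.
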